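(* Let $M\ge 1$ be an integer and $i\in\{1,2,3\}$. The solution $v=\partial_{x_i}\mathcal{L}\big(\prod_{j=1}^3\eta_{2M}\big)$ of the problem $$-\Delta v(\mathbf{x})=\partial_{x_i}\prod_{j=1}^3\eta_{2M}(x_j),\quad \mathbf{x}=(x_1,x_2,x_3)\in\mathbb{R}^3,\qquad |v(\mathbf{x})|\to 0\ \text{ as } |\mathbf{x}|\to\infty,$$ can be expressed by the one-dimensional integral $$\partial_{x_i}\mathcal{L}\Big(\prod_{j=1}^3\eta_{2M}\Big)(\mathbf{x})=-\frac{x_i}{2\pi^{3/2}}\int_0^\infty\frac{e^{-\frac{|\mathbf{x}|^2}{1+r}}}{1+r}\prod_{j=1}^3 \mathcal{Q}_M(x_j,r)\,dr+\frac{1}{4\pi^{3/2}}\int_0^\infty e^{-\frac{|\mathbf{x}|^2}{1+r}}\,\mathcal{R}_M(x_i,r)\prod_{\substack{j=1\\ j\ne i}}^3\mathcal{Q}_M(x_j,r)\,dr,$$ where $$\mathcal{Q}_M(x,r)=\sum_{k=0}^{M-1}\frac{1}{(1+r)^{k+1/2}}\frac{(-1)^k}{4^k\,k!}H_{2k}\Big(\frac{x}{\sqrt{1+r}}\Big),$$ and $\mathcal{R}_1(x,r)=0$, while for $M>1$ $$\mathcal{R}_M(x,r)=\partial_x\mathcal{Q}_M(x,r)=\sum_{k=1}^{M-1}\frac{1}{(1+r)^{k+1}}\frac{(-1)^k}{4^{k-1}(k-1)!}H_{2k-1}\Big(\frac{x}{\sqrt{1+r}}\Big).$$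
   Context: $H_k$ denotes the Hermite polynomials $H_k(x)=(-1)^k e^{x^2}\left(\frac{d}{dx}\right)^k e^{-x^2}$. For an integer $M\ge1$, the one-dimensional generating function is $$\eta_{2M}(x)=\frac{(-1)^{M-1}}{2^{2M-1}\sqrt{\pi}\,(M-1)!}\,\frac{H_{2M-1}(x)\,e^{-x^2}}{x},\qquad x\in\mathbb{R},$$ where the value at $x=0$ is understood by continuous extension (since $H_{2M-1}$ is odd, $H_{2M-1}(x)/x$ is a polynomial). The product $\prod_{j=1}^3\eta_{2M}$ denotes the function $\mathbf{x}=(x_1,x_2,x_3)\mapsto\prod_{j=1}^3\eta_{2M}(x_j)$ on $\mathbb{R}^3$. $\mathcal{L}$ denotes the harmonic potential on $\mathbb{R}^3$, acting on smooth rapidly decaying functions $F$ by $$\mathcal{L}F(\mathbf{x})=\frac{1}{4\pi}\int_{\mathbb{R}^3}\frac{F(\mathbf{y})}{|\mathbf{x}-\mathbf{y}|}\,d\mathbf{y},$$ so that $u=\mathcal{L}F$ is the solution of $-\Delta u=F$ in $\mathbb{R}^3$ with $|u(\mathbf{x})|\to0$ as $|\mathbf{x}|\to\infty$. *)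

(* Defs.v *)
From HB Require Import structures.
From mathcomp Require Import all_boot all_order all_algebra.
From mathcomp Require Import all_classical all_reals all_analysis.
Set Implicit Arguments.
Unset Strict Implicit.
Unset Printing Implicit Defensive.
Import Order.TTheory GRing.Theory Num.Theory.
Import numFieldNormedType.Exports.
Local Open Scope classical_set_scope.
Local Open Scope ring_scope.

(* Points of R^3 are row vectors 'rV[R]_3.  The library norm on row vectors is
   the sup norm; it is used only for its topology.  The norm |x| of the
   mathematics is the Euclidean norm [enorm]. *)

Definition enorm {R : realType} (x : 'rV[R]_3) : R :=
  Num.sqrt (\sum_(j < 3) x 0 j ^+ 2).

Definition partial {R : realType} (j : 'I_3) (f : 'rV[R]_3 -> R) :
    'rV[R]_3 -> R :=
  'D_(delta_mx 0 j) f.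

Definition laplacian {R : realType} (f : 'rV[R]_3 -> R) (x : 'rV[R]_3) : R :=
  \sum_(j < 3) partial j (partial j f) x.

Definition classC1 {R : realType} (f : 'rV[R]_3 -> R) : Prop :=
  forall j : 'I_3,
    (forall x, derivable f x (delta_mx 0 j)) /\ continuous (partial j f).

Definition classC2 {R : realType} (f : 'rV[R]_3 -> R) : Prop :=
  classC1 f /\ forall j : 'I_3, classC1 (partial j f).

Definition vanishes_at_infinity {R : realType} (f : 'rV[R]_3 -> R) : Prop :=
  forall e : R, 0 < e ->
    exists A : R, forall x, A < enorm x -> `|f x| < e.

(* v is a classical solution of - Delta v = g in R^3 with v -> 0 at infinity *)
Definition poisson_solution {R : realType} (g v : 'rV[R]_3 -> R) : Prop :=
  [/\ classC2 v,
      forall x, - laplacian v x = g x &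
      vanishes_at_infinity v].

(* Lebesgue measure on R^3, carried by the iterated product R * R * R, on which
   the library defines product measures. *)
Definition prodR3 (R : realType) :=
  (measurableTypeR R * measurableTypeR R * measurableTypeR R)%type.

Definition lebesgue3 {R : realType} : set (prodR3 R) -> \bar R :=
  ((@lebesgue_measure R \x @lebesgue_measure R) \x @lebesgue_measure R)%E.

HB.instance Definition _ (R : realType) := Measure.on (@lebesgue3 R).

Definition rV3 {R : realType} (p : prodR3 R) : 'rV[R]_3 :=
  \row_(j < 3) [:: (p.1.1 : R); (p.1.2 : R); (p.2 : R)]`_j.

(* At y = x the quotient is F x / 0 = 0 by convention; this is a null set. *)
Definition newton_integrand {R : realType} (F : 'rV[R]_3 -> R)
    (x : 'rV[R]_3) (p : prodR3 R) : R :=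
  F (rV3 p) / enorm (x - rV3 p).

Definition harmonic_potential {R : realType} (F : 'rV[R]_3 -> R)
    (x : 'rV[R]_3) : R :=
  (4 * pi)^-1 * \int[lebesgue3]_p newton_integrand F x p.

Definition hermite {R : realType} (k : nat) (x : R) : R :=
  (-1) ^+ k * expR (x ^+ 2) * derive1n k (fun y : R => expR (- y ^+ 2)) x.

(* eta_{2M} away from 0 *)
Definition eta_quot {R : realType} (M : nat) (x : R) : R :=
  (-1) ^+ M.-1 / (2 ^+ (2 * M).-1 * Num.sqrt pi * M.-1`!%:R)
  * (hermite (2 * M).-1 x * expR (- x ^+ 2) / x).

(* eta_{2M}, with value at 0 given by continuous extension *)
Definition eta {R : realType} (M : nat) (x : R) : R :=
  if x == 0 then lim (eta_quot M y @[y --> (0 : R)^']) else eta_quot M x.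

Definition eta3 {R : realType} (M : nat) (x : 'rV[R]_3) : R :=
  \prod_(j < 3) eta M (x 0 j).

Definition calQ {R : realType} (M : nat) (x r : R) : R :=
  \sum_(0 <= k < M)
    ((1 + r) `^ (k%:R + 2^-1))^-1 * ((-1) ^+ k / (4 ^+ k * k`!%:R))
    * hermite (2 * k) (x / Num.sqrt (1 + r)).

Definition calR {R : realType} (M : nat) (x r : R) : R :=
  if M == 1%N then 0 else derive1 (fun y : R => calQ M y r) x.

(* Main.v *)
Require Import Defs.
From HB Require Import structures.
From mathcomp Require Import all_boot all_order all_algebra.
From mathcomp Require Import all_classical all_reals all_analysis.
From mathcomp Require Import ring lra measurable_realfun gauss_integral.
Set Implicit Arguments.
Unset Strict Implicit.
Unset Printing Implicit Defensive.
Import Order.TTheory GRing.Theory Num.Theory.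
Import numFieldNormedType.Exports.
Local Open Scope classical_set_scope.
Local Open Scope ring_scope.

(** Write s = 1 + r and think of r as four times the time of the heat equation.
    The proof rests on two facts: the inverse of -Delta is the time integral of
    the heat semigroup, and the heat semigroup acts on derivatives of Gaussians
    by a mere rescaling.

    - The product H_k(x) e^(-x^2) is, up to sign, the k-th derivative of the
      Gaussian, and the three-term recurrence of the Hermite polynomials makes
      the quotient defining eta_(2M) telescope: eta_(2M) is the sum over k < M of
      (-1)^k / (4^k k!) times the 2k-th derivative of e^(-x^2) / sqrt pi
      (lemma eta_heat_eta).  The heat flow turns e^(-x^2) into
      s^(-1/2) e^(-x^2/s), hence eta_(2M) into e^(-x^2/s) Q_M(x, r) / sqrt pi
      (lemmas heat_eta0E and eta_conv).

    - The Newton kernel is a time integral of heat kernels,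
      1/|z| = pi^(-1/2) int_0^oo r^(-3/2) e^(-|z|^2/r) dr
      (lemma integral_heat_kernel3).  By Fubini the potential becomes a time
      integral of products of three one-dimensional convolutions, which are known
      from the first point (lemma newton_potential_heat).

    Everything then follows for the functions heat_integral M n, the integrals
    over r of a product of three factors, where n j counts the derivatives that
    fall on the j-th factor.  Every such product is bounded, uniformly in x, by a
    multiple of s^(-3/2); this single dominating function justifies all
    differentiations under the integral sign and shows that partial derivatives
    of heat_integral M n are again of this form, so that they are bounded and the
    functions are smooth.  The heat equation gives Delta = 4 d/dr under the
    integral, and the fundamental theorem of calculus leaves the value at r = 0,
    which is the source term (lemma laplacian_heat_integral).  A derivative gains
    a further factor s^(-1/2), which pays for a factor 1/|x|: this is the decay at
    infinity (lemma heat_integral_vanishes).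

    Uniqueness is the maximum principle for C^2 functions that vanish at infinity
    (lemma poisson_comparison).  Differentiating e^(-x^2/s) Q_M(x, r) by the
    product rule produces the two integrals of the statement. *)

(** * Derivatives of the Gaussian *)

Lemma is_derive_continuous {R : realType} (f : R -> R) (x l : R) :
  is_derive x 1 f l -> {for x, continuous f}.
Proof. by case=> h _; apply: differentiable_continuous; apply/derivable1_diffP. Qed.

Section gauss_polynomials.
Context {R : realType}.
Implicit Types (x y r : R) (n k : nat).

(** The polynomial P_n with (d/dx)^n e^(-x^2) = P_n(x) e^(-x^2), that is (-1)^n H_n:
    this sign makes differentiation a plain shift of n. *)
Fixpoint gauss_poly n : {poly R} :=
  if n is m.+1 then (gauss_poly m)^`() - 2%:R *: ('X * gauss_poly m) else 1.

Lemma gauss_polyS n :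
  gauss_poly n.+1 = (gauss_poly n)^`() - 2%:R *: ('X * gauss_poly n).
Proof. by []. Qed.

Lemma gauss_poly0 : gauss_poly 0 = 1%:P.
Proof. by rewrite polyC1. Qed.

Lemma gauss_poly1 : gauss_poly 1 = - 2%:R *: 'X.
Proof. by rewrite /= -polyC1 derivC sub0r mulr1 scaleNr. Qed.

Lemma deriv_gauss_poly n :
  (gauss_poly n.+1)^`() = - (2 * n.+1%:R) *: gauss_poly n.
Proof.
elim: n => [|n IH].
  by rewrite /= -polyC1 derivC sub0r mulr1 derivN derivZ derivX mulr1 scaleNr polyC1.
rewrite [gauss_poly n.+2]gauss_polyS.
rewrite derivB derivZ derivM derivX mul1r IH derivZ.
rewrite gauss_polyS -[n.+2%:R]natr1.
by rewrite -!mul_polyC !(polyCN, polyCM, polyCD); ring.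
Qed.

Lemma gauss_polySS n : gauss_poly n.+2 =
  - 2%:R *: ('X * gauss_poly n.+1) - (2 * n.+1%:R) *: gauss_poly n.
Proof.
by rewrite gauss_polyS deriv_gauss_poly !scaleNr addrC.
Qed.

(** The three-term recurrence of the Hermite polynomials, obtained from the
    recursive definition because P_(n+1)' = - 2 (n+1) P_n. *)
Lemma horner_gauss_polySS n x : (gauss_poly n.+2).[x] =
  - 2%:R * (x * (gauss_poly n.+1).[x]) - 2 * n.+1%:R * (gauss_poly n).[x].
Proof.
rewrite gauss_polySS; move: (gauss_poly n.+1) (gauss_poly n) => p q.
by rewrite !(hornerD,hornerN,hornerZ,hornerM,hornerX).
Qed.

Lemma is_derive_gauss_poly n x :
  is_derive x 1 (fun y => (gauss_poly n).[y] * gauss_fun y)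
    ((gauss_poly n.+1).[x] * gauss_fun x).
Proof.
have h1 : is_derive x 1 (- (id ^+ 2) : R -> R) (- (2 * x)).
  by apply: is_derive_eq; rewrite expr1 /GRing.scale/= mulr1.
have h2 : is_derive x 1 (@gauss_fun R) (gauss_fun x * - (2 * x)).
  exact: (is_derive1_comp (is_derive_expR _) h1).
apply: (is_derive_eq (is_deriveM (is_derive_poly (gauss_poly n) x) h2)).
rewrite gauss_polyS !(hornerD, hornerN, hornerZ, hornerM, hornerX) /GRing.scale/=.
ring.
Qed.

Lemma derive1n_gauss n :
  derive1n n (@gauss_fun R) = fun x => (gauss_poly n).[x] * gauss_fun x.
Proof.
elim: n => [|n IH].
  by rewrite derive1n0; apply/funext => x; rewrite hornerC mul1r.
rewrite derive1nS IH; apply/funext => x; rewrite derive1E.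
by have -> := @derive_val _ _ _ _ _ _ _ (is_derive_gauss_poly n x).
Qed.

Lemma hermiteE n x : hermite n x = (-1) ^+ n * (gauss_poly n).[x].
Proof.
rewrite /hermite -[fun y => _]/(@gauss_fun R) derive1n_gauss /gauss_fun -!mulrA.
by rewrite [expR (x ^+ 2) * _]mulrC -mulrA [expR (- _) * _]mulrC expRxMexpNx_1 mulr1.
Qed.

(** A monomial is controlled by one term of the exponential series, after the odd
    monomials have been absorbed by |y|^k <= 1 + y^(2k). *)
Lemma poly_le_expR (p : {poly R}) :
  exists2 C : R, 0 <= C & forall y, `|p.[y]| <= C * expR (y ^+ 2 / 2).
Proof.
have mono k y : `|y ^+ k| <= (1 + 2 ^+ k * k`!%:R) * expR (y ^+ 2 / 2).
  have E1 : 1 <= expR (y ^+ 2 / 2).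
    by rewrite -expR0 ler_expR divr_ge0 ?sqr_ge0.
  (* from 0 <= (a - 1)^2 and 0 <= a with a = |y|^k *)
  have h : `|y ^+ k| <= 1 + (`|y| ^+ k) ^+ 2.
    rewrite normrX; set a := `|y| ^+ k.
    have : 0 <= (a - 1) ^+ 2 by apply: sqr_ge0.
    have : 0 <= a by apply: exprn_ge0.
    by nra.
  apply: (le_trans h); rewrite mulrDl mul1r lerD// -exprM mulnC exprM real_normK ?num_real//.
  case: k {h} => [|k]; first by rewrite !expr0 mul1r fact0 mul1r.
  have y0 : 0 <= y ^+ 2 / 2 by rewrite divr_ge0 ?sqr_ge0.
  have h : (y ^+ 2 / 2) ^+ k.+1 / (k.+1)`!%:R <= expR (y ^+ 2 / 2).
    by apply: le_trans (expR_ge1Dxn k y0); rewrite lerDr.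
  rewrite -[leLHS](@mulfK _ (2 ^+ k.+1 * k.+1`!%:R)); last first.
    by rewrite mulf_neq0 ?expf_neq0 ?pnatr_eq0// -lt0n fact_gt0.
  rewrite mulrAC mulrC ler_pM2l; last first.
    by rewrite mulr_gt0 ?exprn_gt0 ?ltr0n ?fact_gt0.
  by apply: le_trans h; rewrite expr_div_n invfM mulrA.
exists (\sum_(k < size p) `|p`_k| * (1 + 2 ^+ k * k`!%:R)).
  by apply: sumr_ge0 => k _; rewrite mulr_ge0// addr_ge0// mulr_ge0// exprn_ge0.
move=> y; rewrite horner_coef mulr_suml; apply: le_trans (ler_norm_sum _ _ _) _.
by apply: ler_sum => k _; rewrite normrM -mulrA ler_wpM2l.
Qed.

(** Half of the Gaussian is spent on the polynomial; the other half remains, which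
    is what makes convolutions of eta with heat kernels integrable in time. *)
Lemma poly_gauss_bound (p : {poly R}) :
  exists2 C : R, 0 <= C & forall y, `|p.[y] * gauss_fun y| <= C * expR (- (y ^+ 2 / 2)).
Proof.
have [C C0 hC] := poly_le_expR p; exists C => // y.
rewrite normrM [X in _ * X]ger0_norm ?expR_ge0// /gauss_fun.
rewrite [y ^+ 2 in leLHS](_ : _ = y ^+ 2 / 2 + y ^+ 2 / 2); last by field.
rewrite opprD expRD mulrA ler_wpM2r ?expR_ge0//.
rewrite (le_trans (ler_wpM2r (expR_ge0 _) (hC y)))//.
by rewrite -mulrA expRxMexpNx_1 mulr1.
Qed.

Lemma poly_gauss_bounded (p : {poly R}) :
  exists2 C : R, 0 <= C & forall y, `|p.[y] * gauss_fun y| <= C.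
Proof.
have [C C0 hC] := poly_gauss_bound p; exists C => // y.
apply: (le_trans (hC y)); rewrite ler_piMr// -expR0 ler_expR oppr_le0.
by rewrite divr_ge0 ?sqr_ge0.
Qed.
End gauss_polynomials.
Arguments gauss_poly {R} n : simpl never.

(** * Derivatives of the Gaussian under the heat flow *)

Section inverse_square_root.
Context {R : realType}.
Implicit Types r : R.

Definition inv_sqrt r : R := (Num.sqrt r)^-1.

Lemma inv_sqrt_ge0 r : 0 <= inv_sqrt r.
Proof. by rewrite invr_ge0 sqrtr_ge0. Qed.

Lemma inv_sqrt_gt0 r : 0 < r -> 0 < inv_sqrt r.
Proof. by move=> r0; rewrite invr_gt0 sqrtr_gt0. Qed.

Lemma inv_sqrt_le0 r : r <= 0 -> inv_sqrt r = 0.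
Proof. by move=> r0; rewrite /inv_sqrt ler0_sqrtr// invr0. Qed.

Lemma inv_sqrtX2 r : 0 < r -> inv_sqrt r ^+ 2 = r^-1.
Proof. by move=> r0; rewrite /inv_sqrt exprVn sqr_sqrtr// ltW. Qed.

Lemma is_derive_inv_sqrt r : 0 < r -> is_derive r 1 inv_sqrt (- 2^-1 * inv_sqrt r ^+ 3).
Proof.
move=> r0.
have s0 : Num.sqrt r != 0 by rewrite sqrtr_eq0 -ltNge.
apply: (is_derive_eq (is_deriveV s0 (is_derive1_sqrt r0))).
by rewrite /inv_sqrt /GRing.scale/=; field.
Qed.

Lemma inv_sqrt_cvg0 : inv_sqrt r @[r --> +oo] --> 0.
Proof.
apply/cvgrPdist_lt => /= e e0; near=> r.
rewrite sub0r normrN ger0_norm ?inv_sqrt_ge0// /inv_sqrt.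
have r0 : 0 < r by near: r; apply: nbhs_pinfty_gt; rewrite num_real.
rewrite -[ltRHS]invrK ltf_pV2 ?posrE ?invr_gt0 ?sqrtr_gt0//.
rewrite -[ltLHS]ger0_norm ?invr_ge0 ?ltW// -sqrtr_sqr ltr_sqrt//.
by near: r; apply: nbhs_pinfty_gt; rewrite num_real.
Unshelve. all: by end_near. Qed.

Lemma inv_sqrt_cvgy : inv_sqrt r @[r --> 0^'+] --> +oo.
Proof.
have s0 : \forall r \near (0 : R)^'+, 0 < Num.sqrt r.
  by near=> r; rewrite sqrtr_gt0.
apply/(cvgrVy s0); rewrite -[X in _ --> X]sqrtr0.
by apply: cvg_at_right_filter; exact: sqrt_continuous.
Unshelve. all: by end_near. Qed.
End inverse_square_root.

Section heat_family.
Context {R : realType}.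
Implicit Types (x y r : R) (n k M : nat).

(** The spatial scale 1 / sqrt (1 + r).  All estimates are stated as powers of this
    quantity, which never exceeds 1. *)
Definition heat_scale r : R := inv_sqrt (1 + r).

(** The n-th x-derivative of (1 + r)^(-1/2) e^(-x^2/(1+r)), the solution at time r/4 of
    the heat equation that starts from e^(-x^2). *)
Definition heat_gauss n x r : R := heat_scale r ^+ n.+1 *
  ((gauss_poly n).[x * heat_scale r] * gauss_fun (x * heat_scale r)).

Definition eta_coef k : R := (-1) ^+ k / (4 ^+ k * k`!%:R).

(** The heat flow applied to the n-th derivative of sqrt pi * eta_(2M).  Keeping n as
    a parameter makes the family closed under d/dx and d/dr. *)
Definition heat_eta M n x r : R :=
  \sum_(k < M) eta_coef k * heat_gauss (2 * k + n) x r.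

Lemma heat_scale_ge0 r : 0 <= heat_scale r.
Proof. exact: inv_sqrt_ge0. Qed.

Lemma heat_scale_le1 r : 0 <= r -> heat_scale r <= 1.
Proof.
move=> r0; have h : 1 <= Num.sqrt (1 + r) by rewrite -[leLHS]sqrtr1 ler_wsqrtr// lerDl.
by rewrite invf_le1// (lt_le_trans _ h).
Qed.

Lemma heat_scale0 : heat_scale 0 = 1.
Proof. by rewrite /heat_scale /inv_sqrt addr0 sqrtr1 invr1. Qed.

Lemma heat_scaleX2 r : -1 < r -> heat_scale r ^+ 2 = (1 + r)^-1.
Proof. by move=> r1; rewrite inv_sqrtX2//; lra. Qed.

Lemma is_derive_heat_scale r : -1 < r ->
  is_derive r 1 heat_scale (- 2^-1 * heat_scale r ^+ 3).
Proof.
move=> r1; have r0 : 0 < 1 + r by lra.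
have h0 : is_derive r 1 (fun y : R => 1 + y) (0 + 1).
  exact: (is_deriveD (is_derive_cst (1 : R) r 1) (is_derive_id r 1)).
have := is_derive1_comp (f := inv_sqrt) (g := fun y : R => 1 + y) (is_derive_inv_sqrt r0) h0.
by rewrite add0r mulr1.
Qed.

Lemma heat_scale_cvg0 : heat_scale r @[r --> +oo] --> 0.
Proof. by apply: cvg_comp inv_sqrt_cvg0; exact: cvg_addrl. Qed.

Lemma is_derive_scaling (f : R -> R) (w x l : R) : is_derive (x * w) 1 f l ->
  is_derive x 1 (fun y => f (y * w)) (l * w).
Proof.
move=> df; have h : is_derive x 1 (fun y : R => y * w) w.
  apply: (is_derive_eq (is_deriveM (is_derive_id x 1) (is_derive_cst w x 1))).
  by rewrite /cst/= scaler0 add0r /GRing.scale/= mulr1.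
exact: (is_derive1_comp (f := f) (g := fun y => y * w) df h).
Qed.

Lemma is_derive_heat_gauss n x r :
  is_derive x 1 (heat_gauss n ^~ r) (heat_gauss n.+1 x r).
Proof.
have h2 := is_derive_scaling (is_derive_gauss_poly n (x * heat_scale r)).
apply: (is_derive_eq (is_deriveZ (heat_scale r ^+ n.+1) h2)).
by rewrite /heat_gauss /GRing.scale/= [heat_scale r ^+ n.+2]exprS; ring.
Qed.

(** By the chain rule d/dr brings out n + 1 copies of P_n and one of X P_(n+1); the
    three-term recurrence identifies their sum with P_(n+2). *)
Lemma heat_equation n x r : -1 < r ->
  is_derive r 1 (heat_gauss n x) (4^-1 * heat_gauss n.+2 x r).
Proof.
move=> r1; have h := is_derive_heat_scale r1.
have h1 : is_derive r 1 (fun s => x * heat_scale s) (x * (- 2^-1 * heat_scale r ^+ 3)).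
  exact: (is_deriveZ x h).
have h2 := is_derive1_comp (is_derive_gauss_poly n _) h1.
have -> : heat_gauss n x = heat_scale ^+ n.+1 *
    ((fun y => (gauss_poly n).[y] * gauss_fun y) \o (fun s => x * heat_scale s)).
  by apply/funext => s; rewrite exprfctE.
apply: (is_derive_eq (is_deriveM (is_deriveX n.+1 h) h2)).
rewrite /heat_gauss horner_gauss_polySS.
rewrite /GRing.scale/= exprfctE !exprS -[n.+1%:R]natr1.
set w := heat_scale r; set g := gauss_fun _; set p := (_).[_]; set q := (_).[_].
by field.
Qed.

(** Polynomials times a Gaussian are bounded, so only the powers of the scale are
    left.  In the second bound the factor x costs one of these powers, because
    x = (x * heat_scale r) / heat_scale r. *)
Lemma heat_gauss_bound n : exists2 C, 0 <= C & forall x r, 0 <= r ->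
  `|heat_gauss n x r| <= C * heat_scale r ^+ n.+1 /\
  `|x * heat_gauss n x r| <= C * heat_scale r ^+ n.
Proof.
have [C C0 hC] := poly_gauss_bounded (gauss_poly n : {poly R}).
have [D D0 hD] := poly_gauss_bounded ('X * gauss_poly n : {poly R}).
exists (C + D); first exact: addr_ge0.
move=> x r r0; have w0 := heat_scale_ge0 r; split.
  rewrite /heat_gauss normrM [X in X * _]ger0_norm ?exprn_ge0// mulrC.
  by rewrite ler_wpM2r ?exprn_ge0// (le_trans (hC _))// lerDl.
have -> : x * heat_gauss n x r =
    heat_scale r ^+ n * (('X * gauss_poly n).[x * heat_scale r] * gauss_fun (x * heat_scale r)).
  by rewrite /heat_gauss hornerM hornerX exprS; ring.
rewrite normrM [X in X * _]ger0_norm ?exprn_ge0// mulrC.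
by rewrite ler_wpM2r ?exprn_ge0// (le_trans (hD _))// lerDr.
Qed.

Lemma is_derive_heat_eta M n x r :
  is_derive x 1 (heat_eta M n ^~ r) (heat_eta M n.+1 x r).
Proof.
have -> : heat_eta M n ^~ r = \sum_(k < M) (eta_coef k *: heat_gauss (2 * k + n) ^~ r).
  by apply/funext => y; rewrite fct_sumE.
have h (k : 'I_M) := is_deriveZ (eta_coef k) (is_derive_heat_gauss (2 * k + n) x r).
apply: (is_derive_eq (is_derive_sum h)).
by apply: eq_bigr => k _; rewrite addnS.
Qed.

Lemma heat_equation_eta M n x r : -1 < r ->
  is_derive r 1 (heat_eta M n x) (4^-1 * heat_eta M n.+2 x r).
Proof.
move=> r1.
have -> : heat_eta M n x = \sum_(k < M) (eta_coef k *: heat_gauss (2 * k + n) x).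
  by apply/funext => y; rewrite fct_sumE.
have h (k : 'I_M) := is_deriveZ (eta_coef k) (heat_equation (2 * k + n) x r1).
apply: (is_derive_eq (is_derive_sum h)); rewrite mulr_sumr.
by apply: eq_bigr => k _; rewrite !addnS /GRing.scale/= mulrCA.
Qed.

(** Since heat_scale r <= 1, the term with fewest derivatives, k = 0, decides. *)
Lemma heat_eta_bound M n : exists2 C, 0 <= C & forall x r, 0 <= r ->
  `|heat_eta M n x r| <= C * heat_scale r ^+ n.+1 /\
  `|x * heat_eta M n x r| <= C * heat_scale r ^+ n.
Proof.
have B k := cid2 (heat_gauss_bound k).
pose D k := sval (B (2 * k + n)%N).
have D0 k : 0 <= D k by rewrite /D; case: (B _).
have DP k x r : 0 <= r -> `|heat_gauss (2 * k + n) x r| <= D k * heat_scale r ^+ (2 * k + n).+1 /\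
    `|x * heat_gauss (2 * k + n) x r| <= D k * heat_scale r ^+ (2 * k + n).
  by rewrite /D; case: (B _) => /= C C0; apply.
exists (\sum_(k < M) `|eta_coef k| * D k).
  by apply: sumr_ge0 => k _; rewrite mulr_ge0.
move=> x r r0; have w0 := heat_scale_ge0 r; have w1 := heat_scale_le1 r0.
split; rewrite /heat_eta ?mulr_sumr mulr_suml;
  apply: (le_trans (ler_norm_sum _ _ _)); apply: ler_sum => k _.
  rewrite normrM -mulrA ler_wpM2l// (le_trans (DP k x r r0).1)//.
  by rewrite ler_wpM2l// ler_wiXn2l// ltnS leq_addl.
rewrite mulrCA normrM -mulrA ler_wpM2l// (le_trans (DP k x r r0).2)//.
by rewrite ler_wpM2l// ler_wiXn2l// leq_addl.
Qed.

(** Multiplied by x, the sum over k < M telescopes by the three-term recurrence to a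
    multiple of the Hermite polynomial of degree 2M - 1.  The value at 0 agrees by
    continuity. *)
Lemma eta_heat_eta M x : (1 <= M)%N -> Defs.eta M x = (Num.sqrt pi)^-1 * heat_eta M 0 x 0.
Proof.
move=> M1.
have sum_hermite m y : y * \sum_(k < m.+1) eta_coef k * (gauss_poly (2 * k)).[y] =
    - (-1) ^+ m / (2 ^+ (2 * m).+1 * m`!%:R) * (gauss_poly (2 * m).+1).[y].
  elim: m => [|m IH].
    rewrite big_ord1 /eta_coef !muln0 gauss_poly1 hornerZ hornerX hornerC.
    by rewrite !expr0 expr1 fact0; field.
  rewrite big_ord_recr /= mulrDr IH mulnS add2n [in RHS]horner_gauss_polySS.
  rewrite /eta_coef !exprS !exprM factS natrM -[(2 * m)%N.+2%:R]natr1 -[(2 * m)%N.+1%:R]natr1.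
  rewrite natrM -[m.+1%:R]natr1.
  set p := (gauss_poly _.+1).[y]; set q := (gauss_poly _).[y].
  have f0 : m`!%:R != 0 :> R by rewrite pnatr_eq0 -lt0n fact_gt0.
  have m0 : m%:R + 1 != 0 :> R by rewrite natr1 pnatr_eq0.
  have -> : 2 ^+ 2 = 4 :> R by ring.
  have t0 : 4 ^+ m != 0 :> R by rewrite expf_neq0.
  set z := 4 ^+ m in t0 *; set s := (-1) ^+ m.
  by field; rewrite f0 m0.
have E y : heat_eta M 0 y 0 =
    (\sum_(k < M) eta_coef k * (gauss_poly (2 * k)).[y]) * gauss_fun y.
  rewrite /heat_eta mulr_suml; apply: eq_bigr => k _.
  by rewrite /heat_gauss heat_scale0 mulr1 expr1n mul1r addn0 mulrA.
have Eq y : y != 0 -> eta_quot M y = (Num.sqrt pi)^-1 * heat_eta M 0 y 0.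
  move=> y0; rewrite E; case: M M1 {E} => // m _; rewrite /eta_quot.
  have -> : (2 * m.+1).-1 = (2 * m).+1 by rewrite mulnS.
  have sgn : (-1) ^+ (2 * m).+1 = -1 :> R.
    by rewrite exprS exprM sqrrN !expr1n mulr1.
  rewrite -[X in _ = _ * (X * _)](mulKf y0) sum_hermite hermiteE sgn.
  rewrite -/(gauss_fun y) [m.+1.-1]/=.
  have f0 : m`!%:R != 0 :> R by rewrite pnatr_eq0 -lt0n fact_gt0.
  have p0 : Num.sqrt pi != 0 :> R by rewrite sqrtr_eq0 -ltNge pi_gt0.
  have t0 : 2 ^+ (2 * m).+1 != 0 :> R by rewrite expf_neq0.
  by field; rewrite f0 p0 t0 y0.
rewrite /Defs.eta; have [->|/Eq//] := eqVneq x 0.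
apply/cvg_lim => //.
have c : (Num.sqrt pi)^-1 * heat_eta M 0 y 0 @[y --> (0 : R)^'] -->
    (Num.sqrt pi)^-1 * heat_eta M 0 0 0.
  apply: cvg_within_filter; apply: cvgM; first exact: cvg_cst.
  exact: (is_derive_continuous (is_derive_heat_eta M 0 0 0)).
apply: cvg_trans c; apply: near_eq_cvg; near=> y; apply/esym/Eq.
by near: y; exact: nbhs_dnbhs_neq.
Unshelve. all: by end_near. Qed.

Lemma calQE M x r : -1 < r -> calQ M x r =
  \sum_(k < M) eta_coef k * (heat_scale r ^+ (2 * k).+1 * (gauss_poly (2 * k)).[x * heat_scale r]).
Proof.
move=> r1; have r0 : 0 < 1 + r by lra.
rewrite /calQ big_mkord; apply: eq_bigr => k _.
rewrite hermiteE exprM sqrrN !expr1n mul1r -/(inv_sqrt (1 + r)) -/(heat_scale r) -/(eta_coef k).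
rewrite powRD; last by rewrite (gt_eqF r0) implybT.
rewrite powR_mulrn ?ltW// powR12_sqrt ?ltW// invfM -/(inv_sqrt (1 + r)) -/(heat_scale r).
by rewrite exprSr exprM heat_scaleX2// exprVn; ring.
Qed.

Lemma gauss_fun_scale x r : -1 < r ->
  gauss_fun (x * heat_scale r) = expR (- (x ^+ 2 / (1 + r))).
Proof. by move=> r1; rewrite /gauss_fun exprMn heat_scaleX2. Qed.

Lemma heat_eta0E M x r : -1 < r ->
  heat_eta M 0 x r = expR (- (x ^+ 2 / (1 + r))) * calQ M x r.
Proof.
move=> r1; rewrite calQE// mulr_sumr; apply: eq_bigr => k _.
by rewrite /heat_gauss addn0 gauss_fun_scale//; ring.
Qed.

Lemma is_derive_calQ M x r : -1 < r ->
  is_derive x 1 (calQ M ^~ r) (\sum_(1 <= k < M)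
     ((1 + r) ^+ k.+1)^-1 * ((-1) ^+ k / (4 ^+ k.-1 * k.-1`!%:R))
         * hermite (2 * k).-1 (x / Num.sqrt (1 + r))).
Proof.
move=> r1.
pose dQ k := eta_coef k * (heat_scale r ^+ (2 * k).+2 * (gauss_poly (2 * k))^`().[x * heat_scale r]).
have dterm k : is_derive x 1
    (fun y => eta_coef k * (heat_scale r ^+ (2 * k).+1 * (gauss_poly (2 * k)).[y * heat_scale r])) (dQ k).
  have h2 := is_derive_scaling (is_derive_poly (gauss_poly (2 * k)) (x * heat_scale r)).
  apply: (is_derive_eq (is_deriveZ (eta_coef k) (is_deriveZ (heat_scale r ^+ (2 * k).+1) h2))).
  by rewrite /dQ /GRing.scale/= [_ ^+ (2 * k).+2]exprS; ring.
have -> : calQ M ^~ r = \sum_(k < M)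
    (fun y => eta_coef k * (heat_scale r ^+ (2 * k).+1 * (gauss_poly (2 * k)).[y * heat_scale r])).
  by apply/funext => y; rewrite fct_sumE calQE.
apply: (is_derive_eq (is_derive_sum (fun k : 'I_M => dterm k))).
rewrite -(big_mkord xpredT dQ).
have dQ0 : dQ 0%N = 0 by rewrite /dQ muln0 gauss_poly0 derivC hornerC !mulr0.
case: M => [|M]; first by rewrite !big_geq.
rewrite big_nat_recl// dQ0 add0r big_add1 succnK; apply: eq_big_nat => k _.
rewrite /dQ mulnS add2n !succnK deriv_gauss_poly hornerZ hermiteE -/(inv_sqrt (1 + r)) -/(heat_scale r).
have -> : heat_scale r ^+ (2 * k).+4 = ((1 + r) ^+ k.+2)^-1.
  by rewrite -exprVn -heat_scaleX2// -exprM; congr (_ ^+ _); rewrite !mulnS.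
have -> : (-1) ^+ (2 * k).+1 = -1 :> R by rewrite exprS exprM sqrrN !expr1n mulr1.
rewrite /eta_coef factS natrM exprS [4 ^+ k.+1]exprS -[(2 * k)%N.+2%:R]natr1 -[(2 * k)%N.+1%:R]natr1.
rewrite natrM -[k.+1%:R]natr1.
have f0 : k`!%:R != 0 :> R by rewrite pnatr_eq0 -lt0n fact_gt0.
have k0 : k%:R + 1 != 0 :> R by rewrite natr1 pnatr_eq0.
have t0 : 4 ^+ k != 0 :> R by rewrite expf_neq0.
have r0 : (1 + r) ^+ k.+2 != 0 by rewrite expf_neq0//; lra.
set a := _ ^+ k.+2 in r0 *; set b := 4 ^+ k in t0 *.
by field; rewrite f0 k0 t0 r0.
Qed.

(** The product rule for e^(-x^2/(1+r)) Q_M(x, r); for M = 1 the derivative of Q_M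
    vanishes, in accordance with the separate definition of R_1. *)
Lemma calR_heat M x r : (1 <= M)%N -> -1 < r ->
  expR (- (x ^+ 2 / (1 + r))) * calR M x r =
  heat_eta M 1 x r + 2 * x / (1 + r) * heat_eta M 0 x r.
Proof.
move=> M1 r1; have dQ := is_derive_calQ M x r1.
have -> : calR M x r = 'D_1 (calQ M ^~ r) x.
  rewrite /calR -derive1E; case: eqP => // ->.
  by rewrite derive1E (@derive_val _ _ _ _ _ _ _ (is_derive_calQ 1 x r1)) big_geq.
have {}dQ : is_derive x 1 (calQ M ^~ r) ('D_1 (calQ M ^~ r) x).
  by apply: derivableP; case: dQ.
have dE : is_derive x 1 (fun y : R => expR (- (y ^+ 2 / (1 + r))))
    (expR (- (x ^+ 2 / (1 + r))) * - (2 * x / (1 + r))).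
  have h : is_derive x 1 (fun y : R => - (y ^+ 2 / (1 + r))) (- (2 * x / (1 + r))).
    have -> : (fun y : R => - (y ^+ 2 / (1 + r))) = - ((1 + r)^-1 *: (id ^+ 2)).
      by apply/funext => y; rewrite !fctE mulrC.
    by apply: is_derive_eq; rewrite /GRing.scale/= expr1; ring.
  exact: (is_derive1_comp (is_derive_expR _) h).
have h := is_deriveM dE dQ.
have E : (fun y : R => expR (- (y ^+ 2 / (1 + r)))) * calQ M ^~ r = heat_eta M 0 ^~ r.
  by apply/funext => y; rewrite fctE heat_eta0E.
rewrite E in h.
have := @derive_val _ _ _ _ _ _ _ h.
rewrite (@derive_val _ _ _ _ _ _ _ (is_derive_heat_eta M 0 x r)) => ->.
by rewrite heat_eta0E// /GRing.scale/=; ring.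
Qed.

End heat_family.

(** * Integrals over time of products of heat-evolved profiles *)

Section integrable_real.
Context {R : realType} d (T : measurableType d) (mu : {measure set T -> \bar R}).
Implicit Types (D : set T) (f g : T -> R).

Lemma integrable_add D f g : measurable D -> mu.-integrable D (EFin \o f) ->
  mu.-integrable D (EFin \o g) -> mu.-integrable D (EFin \o (fun x => f x + g x)).
Proof. by move=> mD i_f i_g; have := integrableD mD i_f i_g; apply: eq_integrable. Qed.

Lemma integrable_scale D f (c : R) : measurable D -> mu.-integrable D (EFin \o f) ->
  mu.-integrable D (EFin \o (fun x => c * f x)).
Proof. by move=> mD i_f; have := integrableZl mD c i_f; apply: eq_integrable. Qed.
End integrable_real.

Lemma is_derive_under_integral {R : realType} d (Y : measurableType d)
    (mu : {measure set Y -> \bar R}) (f f' : R -> Y -> R) (D : set Y) (G : Y -> R) (t : R) :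
  measurable D -> (forall s, mu.-integrable D (EFin \o f s)) ->
  (forall (s : R) y, D y -> is_derive s 1 (f ^~ y) (f' s y)) ->
  (forall y, 0 <= G y) -> mu.-integrable D (EFin \o G) ->
  (forall s y, D y -> `|f' s y| <= G y) ->
  is_derive t 1 (fun s => \int[mu]_(y in D) f s y) (\int[mu]_(y in D) f' t y).
Proof.
move=> mD i_f df G0 iG fG.
have d1E s y : D y -> partial1of2 f s y = f' s y.
  by move=> Dy; rewrite partial1of2E; apply: derive_val; exact: df.
have It : (`]t - 1, t + 1[%classic : set R) t by rewrite /= in_itv/=; lra.
have L : h^-1 *: ((\int[mu]_(y in D) f (h + t) y) - \int[mu]_(y in D) f t y) @[h --> 0^']
    --> \int[mu]_(y in D) f' t y.
  rewrite (_ : \int[mu]_(y in D) f' t y = \int[mu]_(y in D) partial1of2 f t y); last first.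
    by apply: eq_Rintegral => y; rewrite inE => /d1E ->.
  apply: (cvg_differentiation_under_integral mD It _ _ G0 iG) => [s _|s y _ Dy|s y _ Dy].
  - exact: i_f.
  - by have [] := df s y Dy.
  - by rewrite d1E//; exact: fG.
have E : (fun h : R => h^-1 *: (((fun s => \int[mu]_(y in D) f s y) \o shift t) (h *: (1 : R))
     - \int[mu]_(y in D) f t y)) =
  (fun h => h^-1 *: ((\int[mu]_(y in D) f (h + t) y) - \int[mu]_(y in D) f t y)).
  by apply/funext => h /=; rewrite [h *: 1]mulr1.
apply: DeriveDef; first by apply/cvg_ex; exists (\int[mu]_(y in D) f' t y); rewrite E.
by rewrite /derive E; apply/cvg_lim.
Qed.

Section heat_integral.
Context {R : realType}.
Implicit Types (x : 'rV[R]_3) (r : R) (n : 'I_3 -> nat) (M : nat) (j : 'I_3).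
Local Notation mu := (@lebesgue_measure R).

Lemma prod3E (f : 'I_3 -> R) :
  \prod_(j < 3) f j = f 0 * f 1 * f ord_max.
Proof.
rewrite !big_ord_recl big_ord0 mulr1 mulrA.
by congr (f _ * f _ * f _); apply/val_inj.
Qed.

Lemma sum3E (V : nmodType) (f : 'I_3 -> V) :
  \sum_(j < 3) f j = f 0 + f 1 + f ord_max.
Proof.
rewrite !big_ord_recl big_ord0 addr0 addrA.
by congr (f _ + f _ + f _); apply/val_inj.
Qed.

(** A directional derivative is the derivative at 0 along a line.  Both sides are
    limits of the same difference quotients. *)
Lemma is_derive_line (f : 'rV[R]_3 -> R) x v (l : R) :
  is_derive (0 : R) 1 (fun t => f (t *: v + x)) l -> is_derive x v f l.
Proof.
move=> [h1 h2].
have E : (fun h : R => h^-1 *: ((f \o shift x) (h *: v) - f x)) =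
   (fun h => h^-1 *: (((fun t => f (t *: v + x)) \o shift 0) (h *: (1:R)) - f (0 *: v + x))).
  by apply/funext => h /=; rewrite scale0r add0r addr0 [h *: 1]mulr1.
apply: DeriveDef; first by rewrite /derivable E.
by rewrite /derive E.
Qed.

Lemma derive_along (f : 'rV[R]_3 -> R) x v (t : R) : derivable f (t *: v + x) v ->
  is_derive t 1 (fun s => f (s *: v + x)) ('D_v f (t *: v + x)).
Proof.
move=> h.
have E : (fun h : R => h^-1 *: ((f \o shift (t *: v + x)) (h *: v) - f (t *: v + x))) =
   (fun h => h^-1 *: (((fun s => f (s *: v + x)) \o shift t) (h *: (1:R)) - f (t *: v + x))).
  apply/funext => s /=; congr (_ *: (f _ - _)).
  by rewrite [s *: 1]mulr1 scalerDl addrA.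
move: h; rewrite /derivable E => h.
by apply: DeriveDef; [exact: h|rewrite /derive E].
Qed.

Lemma coord_line j k x (t : R) :
  (t *: delta_mx 0 j + x) 0 k = (if k == j then t else 0) + x 0 k.
Proof.
by rewrite !mxE eqxx /=; case: eqP => _; rewrite /= ?mulr1 ?mulr0.
Qed.

Lemma cvg_at_right_derivable (f : R -> R) (a l : R) :
  is_derive a 1 f l -> f x @[x --> a^'+] --> f a.
Proof. by move=> /is_derive_continuous h; apply: cvg_at_right_filter. Qed.

(** The primitive is -2 heat_scale, because heat_scale' = - heat_scale^3 / 2. *)
Lemma integral_heat_scale3 :
  (\int[mu]_(r in `[0%R, +oo[) (heat_scale r ^+ 3)%:E = 2%:E)%E.
Proof.
have d r : -1 < r -> is_derive r 1 (fun r : R => - 2 * heat_scale r) (heat_scale r ^+ 3).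
  move=> r1; apply: (is_derive_eq (is_deriveZ (-2) (is_derive_heat_scale r1))).
  by rewrite /GRing.scale/=; field.
rewrite (@ge0_continuous_FTC2y _ _ (fun r : R => - 2 * heat_scale r) 0 0).
- by rewrite heat_scale0 sub0e mulr1 -EFinN opprK.
- by move=> r r0; rewrite exprn_ge0// heat_scale_ge0.
- apply: continuous_in_subspaceT => r; rewrite inE/= in_itv/= andbT => r0.
  apply: (cvg_comp heat_scale (fun y => y ^+ 3)); last exact: exprn_continuous.
  by apply: is_derive_continuous; apply: is_derive_heat_scale; lra.
- by rewrite -[X in _ --> X](mulr0 (- 2)); apply: cvgMr; exact: heat_scale_cvg0.
- by move=> r r0; have [] := d r (ltac:(lra)).
- by apply: cvg_at_right_derivable; apply: d; lra.
- by move=> r; rewrite in_itv/= andbT => r0; rewrite derive1E; apply: derive_val; apply: d; lra.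
Qed.

Lemma measurable_continuous_itv0y (f : R -> R) :
  (forall r, 0 <= r -> {for r, continuous f}) -> measurable_fun (`[0, +oo[%classic : set R) f.
Proof.
move=> cf; apply: subspace_continuous_measurable_fun => //.
by apply: continuous_in_subspaceT => r; rewrite inE/= in_itv/= andbT; exact: cf.
Qed.

Lemma continuous_heat_scale3 (C r : R) : 0 <= r ->
  {for r, continuous (fun r => C * heat_scale r ^+ 3)}.
Proof.
move=> r0; apply: cvgM; first exact: cvg_cst.
apply: (cvg_comp heat_scale (fun y => y ^+ 3)); last exact: exprn_continuous.
by apply: is_derive_continuous; apply: is_derive_heat_scale; lra.
Qed.

Lemma integrable_heat_scale3 (C : R) :
  mu.-integrable `[0, +oo[ (EFin \o (fun r : R => C * heat_scale r ^+ 3)).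
Proof.
have E1 : (fun r : R => heat_scale r ^+ 3) = (fun r => 1 * heat_scale r ^+ 3).
  by apply/funext => r; rewrite mul1r.
have iw : mu.-integrable `[0, +oo[ (EFin \o (fun r : R => heat_scale r ^+ 3)).
  apply/integrableP; split.
    apply/measurable_EFinP; rewrite E1.
    by apply: measurable_continuous_itv0y => r r0; exact: continuous_heat_scale3.
  under eq_integral do rewrite /= ger0_norm ?exprn_ge0 ?heat_scale_ge0//.
  by rewrite integral_heat_scale3 ltry.
exact: integrable_scale.
Qed.

Lemma Rintegral_heat_scale3 (C : R) :
  \int[mu]_(r in `[0, +oo[) (C * heat_scale r ^+ 3) = C * 2.
Proof.
have i1 := integrable_heat_scale3 1.
rewrite RintegralZl ?/Rintegral ?integral_heat_scale3//.
by move: i1; apply: eq_integrable => // r _; rewrite /= mul1r.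
Qed.

(** The one domination criterion behind all integrals over r: the majorant
    (1 + r)^(-3/2) has integral 2. *)
Lemma heat_dominated (f : R -> R) (C : R) :
  (forall r, 0 <= r -> {for r, continuous f}) ->
  (forall r, 0 <= r -> `|f r| <= C * heat_scale r ^+ 3) ->
  mu.-integrable `[0, +oo[ (EFin \o f) /\
  `|\int[mu]_(r in `[0, +oo[) f r| <= C * 2.
Proof.
move=> cf fC.
have i_f : mu.-integrable `[0, +oo[ (EFin \o f).
  apply: le_integrable (integrable_heat_scale3 C) => //.
    by apply/measurable_EFinP; exact: measurable_continuous_itv0y.
  move=> r /=; rewrite in_itv/= andbT => r0; rewrite lee_fin (le_trans (fC r r0))//.
  exact: ler_norm.
split=> //; apply: (le_trans (le_normr_Rintegral _ i_f)) => //.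
rewrite -Rintegral_heat_scale3; apply: le_Rintegral => //.
- exact: integrable_norm.
- exact: integrable_heat_scale3.
- by move=> r /=; rewrite in_itv/= andbT; exact: fC.
Qed.

Definition heat_prod M n x r : R := \prod_(j < 3) heat_eta M (n j) (x 0 j) r.

Definition heat_integral M n x : R :=
  \int[mu]_(r in `[0, +oo[) heat_prod M n x r.

Definition incr n j : 'I_3 -> nat := fun k => (n k + (k == j))%N.

Lemma continuous_heat_prod M n x r : 0 <= r -> {for r, continuous (heat_prod M n x)}.
Proof.
move=> r0.
have h (j : 'I_3) : heat_eta M (n j) (x 0 j) s @[s --> r] --> heat_eta M (n j) (x 0 j) r.
  by apply: is_derive_continuous; apply: heat_equation_eta; lra.
rewrite /prop_for /continuous_at /heat_prod prod3E.
under eq_fun do rewrite prod3E.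
by apply: cvgM; [apply: cvgM|]; exact: h.
Qed.

(** Each of the three factors contributes at least one power of heat_scale. *)
Lemma heat_prod_bound M n : exists2 C, 0 <= C & forall x r, 0 <= r ->
  `|heat_prod M n x r| <= C * heat_scale r ^+ 3.
Proof.
have B k := cid2 (@heat_eta_bound R M k).
pose D k := sval (B k).
have D0 k : 0 <= D k by rewrite /D; case: (B _).
have DP k (y r : R) : 0 <= r -> `|heat_eta M k y r| <= D k * heat_scale r.
  move=> r0; rewrite /D; case: (B _) => /= C C0 h.
  apply: (le_trans (h y r r0).1); rewrite ler_wpM2l// -[leRHS]expr1.
  by rewrite ler_wiXn2l ?heat_scale_ge0 ?heat_scale_le1.
exists (\prod_(j < 3) D (n j)); first exact: prodr_ge0.
move=> x r r0; rewrite /heat_prod normr_prod.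
have -> : (\prod_(j < 3) D (n j)) * heat_scale r ^+ 3 = \prod_(j < 3) (D (n j) * heat_scale r).
  by rewrite big_split /= prodr_const card_ord.
by apply: ler_prod => j _; rewrite normr_ge0 DP.
Qed.

Lemma integrable_heat_prod M n x : mu.-integrable `[0, +oo[ (EFin \o heat_prod M n x).
Proof.
have [C C0 hC] := heat_prod_bound M n.
by have [] := heat_dominated (@continuous_heat_prod M n x) (hC x).
Qed.

Lemma heat_integral_bound M n : exists2 C, 0 <= C & forall x, `|heat_integral M n x| <= C.
Proof.
have [C C0 hC] := heat_prod_bound M n.
exists (C * 2); first by rewrite mulr_ge0.
by move=> x; have [] := heat_dominated (@continuous_heat_prod M n x) (hC x).
Qed.

Lemma is_derive_prod_line (f df : 'I_3 -> R -> R) x j (t : R) :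
  (forall k (y : R), is_derive y 1 (f k) (df k y)) ->
  is_derive t 1 (fun s => \prod_(k < 3) f k ((s *: delta_mx 0 j + x) 0 k))
    (\prod_(k < 3) (if k == j then df k else f k) ((t *: delta_mx 0 j + x) 0 k)).
Proof.
move=> hf; rewrite (bigD1 j)//= eqxx.
under eq_fun do rewrite (bigD1 j)//= coord_line eqxx.
have E s : \prod_(k < 3 | k != j) f k ((s *: delta_mx 0 j + x) 0 k) =
    \prod_(k < 3 | k != j) f k (x 0 k).
  by apply: eq_bigr => k /negPf kj; rewrite coord_line kj add0r.
under eq_fun do rewrite E.
have -> : \prod_(k < 3 | k != j) (if k == j then df k else f k) ((t *: delta_mx 0 j + x) 0 k) =
    \prod_(k < 3 | k != j) f k (x 0 k).
  by apply: eq_bigr => k /negPf kj; rewrite coord_line kj add0r.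
rewrite coord_line eqxx; set c := \prod_(_ < _ | _) _.
have h : is_derive t 1 (fun s : R => s + x 0 j) (1 + 0).
  exact: (is_deriveD (is_derive_id t 1) (is_derive_cst (x 0 j) t 1)).
have h2 := is_derive1_comp (f := f j) (g := fun s => s + x 0 j) (hf j (t + x 0 j)) h.
have -> : (fun s => f j (s + x 0 j) * c) = c *: (f j \o (fun s => s + x 0 j)).
  by apply/funext => s; rewrite /= mulrC.
by apply: (is_derive_eq (is_deriveZ c h2)); rewrite /GRing.scale/= addr0 mulr1 mulrC.
Qed.

(** Along the j-th axis only the j-th factor moves. *)
Lemma is_derive_heat_prod_line M n x j r (t : R) :
  is_derive t 1 (fun s => heat_prod M n (s *: delta_mx 0 j + x) r)
    (heat_prod M (incr n j) (t *: delta_mx 0 j + x) r).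
Proof.
have h k (y : R) := is_derive_heat_eta M (n k) y r.
apply: (is_derive_eq (is_derive_prod_line x j t h)).
apply: eq_bigr => k _; rewrite /incr.
by case: eqP => _ /=; rewrite ?addn1 ?addn0.
Qed.

Lemma is_derive_heat_integral M n x j :
  is_derive x (delta_mx 0 j) (heat_integral M n) (heat_integral M (incr n j) x).
Proof.
apply: is_derive_line.
have [C C0 hC] := heat_prod_bound M (incr n j).
have iG := integrable_heat_scale3 C.
have -> : heat_integral M (incr n j) x = heat_integral M (incr n j) (0 *: delta_mx 0 j + x).
  by rewrite scale0r add0r.
pose f (t r : R) := heat_prod M n (t *: delta_mx 0 j + x) r.
pose f' (t r : R) := heat_prod M (incr n j) (t *: delta_mx 0 j + x) r.
suff : is_derive (0 : R) 1 (fun t => \int[mu]_(r in `[0, +oo[) f t r)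
    (\int[mu]_(r in `[0, +oo[) f' 0 r) by [].
have under_int := @is_derive_under_integral R _ _ mu f f' `[0, +oo[%classic
  (fun r : R => C * heat_scale r ^+ 3) 0 _ _ _ _ iG _.
apply: under_int => //.
- by move=> t; exact: integrable_heat_prod.
- by move=> t r _; exact: is_derive_heat_prod_line.
- by move=> r; rewrite mulr_ge0// exprn_ge0// heat_scale_ge0.
- by move=> t r; rewrite /= in_itv/= andbT => r0; apply: hC.
Qed.
End heat_integral.

(** * The maximum principle *)

Section several_variables.
Context {R : realType}.
Implicit Types (x y : 'rV[R]_3) (j k : 'I_3) (f g w v : 'rV[R]_3 -> R).

Lemma mean_value_bound (g g' : R -> R) (b C : R) :
  (forall t : R, `|t| <= `|b| -> is_derive t 1 g (g' t)) ->
  (forall t, `|t| <= `|b| -> `|g' t| <= C) -> `|g b - g 0| <= C * `|b|.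
Proof.
move=> dg bg.
have cg (t : R) : `|t| <= `|b| -> {for t, continuous g}.
  by move=> /dg; exact: is_derive_continuous.
have [b0|b0|->] := ltgtP b 0; last by rewrite subrr normr0 mulr0.
- have ab t : b <= t -> t <= 0 -> `|t| <= `|b| by move=> *; rewrite !ler0_norm//; lra.
  have [||c] := MVT b0 (f := g) (df := g').
  + by move=> t; rewrite in_itv/= => /andP[t1 t2]; apply/dg/ab; apply/ltW.
  + apply: continuous_in_subspaceT => t; rewrite inE/= in_itv/= => /andP[t1 t2].
    exact/cg/ab.
  rewrite in_itv/= sub0r distrC => /andP[c1 c2] ->.
  by rewrite normrM normrN ler_wpM2r// bg// ab// ltW.
- have ab t : 0 <= t -> t <= b -> `|t| <= `|b| by move=> *; rewrite !ger0_norm//; lra.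
  have [||c] := MVT b0 (f := g) (df := g').
  + by move=> t; rewrite in_itv/= => /andP[t1 t2]; apply/dg/ab; apply/ltW.
  + apply: continuous_in_subspaceT => t; rewrite inE/= in_itv/= => /andP[t1 t2].
    exact/cg/ab.
  rewrite in_itv/= subr0 => /andP[c1 c2] ->.
  by rewrite normrM ler_wpM2r// bg// ab// ltW.
Qed.

(** A point is joined to a nearby one by a path that changes one coordinate at a
    time.  The path stays in a ball of the sup norm, so the mean value theorem on
    each piece bounds the increment by the bound on the partial derivatives. *)
Lemma continuous_bounded_partials f :
  (forall j x, derivable f x (delta_mx 0 j)) ->
  (forall x, exists C, \forall y \near x, forall j, `|partial j f y| <= C) ->
  continuous f.
Proof.
move=> df bf x; have [C] := bf x => /nbhs_ballP[e /= e0 hC].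
have C0 : 0 <= C by apply: le_trans (hC x (ballxx _ e0) ord0).
have Fx : Filter (nbhs x) := nbhs_filter x.
suff near_fx : forall eps : R, 0 < eps -> nbhs x [set y | `|f x - f y| < eps].
  by apply/cvgrPdist_lt => eps eps0; exact: near_fx.
move=> eps eps0; apply/nbhs_ballP.
pose d := Num.min e (eps / (3 * C + 1)).
have d0 : 0 < d by rewrite lt_min e0 divr_gt0//; lra.
have de : d <= e by rewrite ge_min lexx.
have dC : d * (3 * C + 1) <= eps.
  by rewrite -ler_pdivlMr ?ge_min ?lexx ?orbT//; lra.
exists d => //= y [_ yx].
have {}yx j : `|y 0 j - x 0 j| < d by rewrite distrC; exact: yx.
(* z m agrees with y in the first m coordinates and with x in the others *)
pose z (m : nat) : 'rV[R]_3 := \row_j (if (j < m)%N then y 0 j else x 0 j).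
have z0 : z 0%N = x by apply/rowP => j; rewrite mxE.
have z3 : z 3%N = y by apply/rowP => j; rewrite mxE ltn_ord.
have zS (j : 'I_3) : z j.+1 = (y 0 j - x 0 j) *: delta_mx 0 j + z j.
  apply/rowP => k; rewrite coord_line !mxE ltnS leq_eqVlt -val_eqE.
  by case: ltngtP => //= h; rewrite ?add0r//; rewrite (ord_inj h); ring.
have step (j : 'I_3) : `|f (z j.+1) - f (z j)| <= C * `|y 0 j - x 0 j|.
  rewrite zS; set b := y 0 j - x 0 j.
  have := @mean_value_bound (fun t => f (t *: delta_mx 0 j + z j))
    (fun t => partial j f (t *: delta_mx 0 j + z j)) b C.
  rewrite scale0r add0r; apply => t tb; first exact: derive_along.
  apply: hC; split=> // i k; rewrite ord1.
  rewrite /ball/= coord_line mxE; case: eqP => [->|_].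
    rewrite ltnn distrC addrK; apply: le_lt_trans tb _.
    exact: lt_le_trans (yx j) de.
  rewrite add0r; case: ifP => _; last by rewrite subrr normr0.
  by rewrite distrC; exact: lt_le_trans (yx k) de.
rewrite /=; have -> : f x - f y = - \sum_(j < 3) (f (z j.+1) - f (z j)).
  by rewrite sum3E /= z0 z3; ring.
rewrite normrN; apply: le_lt_trans (ler_norm_sum _ _ _) _.
apply: (@le_lt_trans _ _ (\sum_(j < 3) C * d)).
  apply: ler_sum => j _; apply: le_trans (step j) _.
  by rewrite ler_wpM2l// ltW.
rewrite sumr_const card_ord -mulr_natl; apply: lt_le_trans dC.
by lra.
Qed.

Lemma continuous_classC1 f : classC1 f -> continuous f.
Proof.
move=> hf; apply: continuous_bounded_partials => [j|x]; first by case: (hf j).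
exists (\sum_(j < 3) (`|partial j f x| + 1)).
have h j : \forall y \near x, `|partial j f y| <= `|partial j f x| + 1.
  have /cvgrPdist_lt/(_ 1 ltr01) := (hf j).2 x.
  apply: filterS => y yx; rewrite -lerBlDl ltW//.
  by apply: le_lt_trans yx; rewrite -normrN opprB (le_trans _ (ler_dist_dist _ _))// ler_norm.
have := filter_forall (nbhs_filter x) h; apply: filterS => y hy j.
apply: le_trans (hy j) _; rewrite (bigD1 j)//= lerDl.
by apply: sumr_ge0 => k _; rewrite addr_ge0.
Qed.

(** If the second derivative were positive, the first derivative, which vanishes at
    the maximum, would be positive just to the right of it. *)
Lemma second_derive_at_max (g g' : R -> R) (l e : R) : 0 < e ->
  (forall t : R, `|t| < e -> is_derive t 1 g (g' t)) -> is_derive (0 : R) 1 g' l ->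
  (forall t, `|t| < e -> g t <= g 0) -> l <= 0.
Proof.
move=> e0 dg dg' gmax.
have e00 : `|0 : R| < e by rewrite normr0.
have it t : t \in `](-e), e[ -> `|t| < e by rewrite in_itv/= ltr_norml.
have g'0 : g' 0 = 0.
  have ee : - e <= e by lra.
  have z : (0 : R) \in `](-e), e[ by rewrite in_itv/=; lra.
  have h := derive1_at_max (f := g) ee (fun t ht => ltac:(by have [] := dg t (it t ht))) z
    (fun t ht => gmax t (it t ht)).
  by rewrite -(@derive_val _ _ _ _ _ _ _ (dg 0 e00)) (@derive_val _ _ _ _ _ _ _ h).
rewrite leNgt; apply/negP => l0.
have lim : h^-1 *: (g' (h + 0) - g' 0) @[h --> 0^'] --> l.
  case: dg' => d1 d2; move: d1; rewrite /derivable => /cvg_ex[l' hl'].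
  have : l' = l by rewrite -d2; apply/esym/cvg_lim.
  move=> <-; move: hl'; under eq_fun do rewrite /= [_ *: 1]mulr1.
  exact.
have /cvgrPdist_lt/(_ l l0)/nbhs_ballP[d /= d0 hd] := lim.
pose t := Num.min d e / 2.
have m0 : 0 < Num.min d e by rewrite lt_min d0.
have t0 : 0 < t by rewrite divr_gt0.
have td : t < d by have : Num.min d e <= d; [rewrite ge_min lexx|rewrite /t; lra].
have te : t < e by have : Num.min d e <= e; [rewrite ge_min lexx orbT|rewrite /t; lra].
have ab s : 0 <= s -> s <= t -> `|s| < e by move=> s0 st; rewrite ger0_norm//; lra.
have [||c] := MVT t0 (f := g) (df := g').
- by move=> s; rewrite in_itv/= => /andP[s1 s2]; apply/dg/ab; apply/ltW.
- apply: continuous_in_subspaceT => s; rewrite inE/= in_itv/= => /andP[s1 s2].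
  exact/is_derive_continuous/dg/ab.
rewrite in_itv/= subr0 => /andP[c0 ct] E.
have := hd c; rewrite /ball/= sub0r normrN ger0_norm ?(ltW c0)//.
move=> /(_ (lt_trans ct td) (lt0r_neq0 c0)).
rewrite addr0 g'0 subr0 /GRing.scale/= ltr_norml => /andP[_ h].
have {}h : 0 < c^-1 * g' c by lra.
have g'c : 0 < g' c by move: h; rewrite pmulr_rgt0// invr_gt0.
have := gmax t (ab t (ltW t0) (lexx t)).
by rewrite -subr_le0 E leNgt mulr_gt0.
Qed.

Lemma sqnorm_line j x (t : R) :
  \sum_(k < 3) ((t *: delta_mx 0 j + x) 0 k) ^+ 2 =
  t ^+ 2 + 2 * x 0 j * t + \sum_(k < 3) x 0 k ^+ 2.
Proof.
rewrite [in LHS](bigD1 j)//= [in RHS](bigD1 j)//= coord_line eqxx addrA.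
congr (_ + _); first ring.
by apply: eq_bigr => k /negPf kj; rewrite coord_line kj add0r.
Qed.

Lemma enorm_sqr x : enorm x ^+ 2 = \sum_(j < 3) x 0 j ^+ 2.
Proof. by rewrite /enorm sqr_sqrtr// sumr_ge0// => j _; rewrite sqr_ge0. Qed.

Lemma enorm_ge0 x : 0 <= enorm x. Proof. exact: sqrtr_ge0. Qed.

Lemma coord_le_enorm j x : `|x 0 j| <= enorm x.
Proof.
rewrite -sqrtr_sqr /enorm ler_wsqrtr// (bigD1 j)//= lerDl.
by rewrite sumr_ge0// => k _; rewrite sqr_ge0.
Qed.

Lemma continuous_sqnorm : continuous (fun x : 'rV[R]_3 => \sum_(j < 3) x 0 j ^+ 2).
Proof.
have h j : continuous ((fun y : R => y ^+ 2) \o (fun y : 'rV[R]_3 => y 0 j)).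
  by move=> x; apply: continuous_comp; [exact: coord_continuous|exact: exprn_continuous].
have -> : (fun x : 'rV[R]_3 => \sum_(j < 3) x 0 j ^+ 2) = \sum_(j < 3)
    ((fun y : R => y ^+ 2) \o (fun y : 'rV[R]_3 => y 0 j)).
  by apply/funext => x; rewrite fct_sumE.
move=> x; rewrite sum3E.
by apply: continuousD; [apply: continuousD|]; exact: h.
Qed.

Lemma closed_enorm_ball_compact (A : R) : 0 <= A -> compact [set x | enorm x <= A].
Proof.
move=> A0; apply: bounded_closed_compact.
  exists A; split; first exact: num_real.
  move=> B AB x /= xA; rewrite /Num.Def.normr/= mx_normrE.
  apply: bigmax_le; first by rewrite (le_trans A0)// ltW.
  move=> [i j] _ /=; rewrite ord1 (le_trans (coord_le_enorm j x))// (le_trans xA)//.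
  exact: ltW.
have -> : [set x | enorm x <= A] =
    (fun x : 'rV[R]_3 => \sum_(j < 3) x 0 j ^+ 2) @^-1` [set y | y <= A ^+ 2].
  apply/seteqP; split => x /=; rewrite -enorm_sqr.
    by move=> h; rewrite lerXn2r ?nnegrE ?enorm_ge0.
  by rewrite ler_sqr ?nnegrE ?enorm_ge0.
apply: closed_comp; last exact: closed_le.
by move=> x _; exact: continuous_sqnorm.
Qed.

(** If w - v were positive somewhere, w - v + eps |x|^2 would have an interior
    maximum in a large ball, for eps small: outside, w - v is small by the
    conditions at infinity.  There the Laplacian is nonpositive, whereas that of
    w - v + eps |x|^2 is 6 eps. *)
Lemma poisson_comparison (g w v : 'rV[R]_3 -> R) :
  poisson_solution g w -> poisson_solution g v -> forall x, w x <= v x.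
Proof.
move=> [w2 wg w0] [v2 vg v0] a; rewrite leNgt; apply/negP => va.
pose d := w a - v a; have d0 : 0 < d by rewrite subr_gt0.
have d4 : 0 < d / 4 by rewrite divr_gt0.
have [A1 hA1] := w0 _ d4; have [A2 hA2] := v0 _ d4.
pose A := Num.max (Num.max A1 A2) (enorm a).
pose B := A + 1.
have aA : enorm a <= A by rewrite le_max lexx orbT.
have A0 : 0 <= A by apply: le_trans aA; exact: enorm_ge0.
have far x : A < enorm x -> w x - v x < d / 2.
  rewrite !gt_max => /andP[/andP[/hA1 h1 /hA2 h2] _].
  by move: h1 h2; rewrite !ltr_norml => /andP[_ h1] /andP[h2 _]; lra.
have B0 : 0 < B by rewrite /B; lra.
(* on the ball of radius B the penalty eps |x|^2 is at most d / 4, too little to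
   move the maximum outside the ball of radius A *)
pose eps := d / (4 * B ^+ 2).
have eps0 : 0 < eps by rewrite divr_gt0// mulr_gt0// exprn_gt0.
have epsB : eps * B ^+ 2 = d / 4 by rewrite /eps; field; rewrite gt_eqF.
pose q x : R := \sum_(j < 3) x 0 j ^+ 2.
pose f x := w x - v x + eps * q x.
have cf : continuous f.
  have -> : f = w - v + cst eps * q by [].
  have cw := continuous_classC1 w2.1; have cv := continuous_classC1 v2.1.
  move=> x; apply: continuousD; first by apply: continuousB; [exact: cw|exact: cv].
  by apply: continuousM; [exact: cst_continuous|exact: continuous_sqnorm].
have [|||m] := @EVT_max_rV R 3 f [set x | enorm x <= B].
- by exists a; rewrite /= /B; lra.
- by apply: closed_enorm_ball_compact; exact: ltW.
- exact: continuous_subspaceT.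
rewrite inE /= => mB fmax.
have q0 x : 0 <= q x by rewrite sumr_ge0// => j _; rewrite sqr_ge0.
have dm : d <= f m.
  apply: (@le_trans _ _ (f a)); first by rewrite /f -/d lerDl mulr_ge0// ltW.
  by apply: fmax; rewrite inE /= /B; lra.
have mA : enorm m <= A.
  rewrite leNgt; apply/negP => /far h; move: dm; rewrite /f leNgt => /negP; apply.
  have qB : eps * q m <= d / 4.
    by rewrite -epsB (ler_wpM2l (ltW eps0))// /q -enorm_sqr lerXn2r ?nnegrE ?enorm_ge0 ?(ltW B0).
  lra.
have line j : partial j (partial j w) m - partial j (partial j v) m + 2 * eps <= 0.
  have lw t := @derive_along _ w m (delta_mx 0 j) t ((w2.1 j).1 _).
  have lv t := @derive_along _ v m (delta_mx 0 j) t ((v2.1 j).1 _).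
  have fE t : f (t *: delta_mx 0 j + m) = w (t *: delta_mx 0 j + m)
      - v (t *: delta_mx 0 j + m) + eps * (t ^+ 2 + 2 * m 0 j * t + q m).
    by rewrite /f /q sqnorm_line.
  (* radius 1 suffices, as |m| <= A = B - 1 *)
  apply: (@second_derive_at_max (fun t => f (t *: delta_mx 0 j + m))
    (fun t => partial j w (t *: delta_mx 0 j + m) - partial j v (t *: delta_mx 0 j + m)
       + eps * (2 * t + 2 * m 0 j)) _ 1 ltr01).
  - move=> t _; under eq_fun do rewrite fE.
    have h : is_derive t 1 (fun t : R => eps * (t ^+ 2 + 2 * m 0 j * t + q m)) (eps * (2 * t + 2 * m 0 j)).
      have -> : (fun t : R => eps * (t ^+ 2 + 2 * m 0 j * t + q m)) =
        eps *: (id ^+ 2 + (2 * m 0 j) *: id + cst (q m)) by [].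
      by apply: is_derive_eq; rewrite /GRing.scale/= expr1; ring.
    exact: (is_deriveD (is_deriveB (lw t) (lv t)) h).
  - have h : is_derive (0 : R) 1 (fun t : R => eps * (2 * t + 2 * m 0 j)) (2 * eps).
      have -> : (fun t : R => eps * (2 * t + 2 * m 0 j)) =
        eps *: (2 *: id + cst (2 * m 0 j)) by [].
      by apply: is_derive_eq; rewrite /GRing.scale/=; ring.
    have l2w := @derive_along _ (partial j w) m (delta_mx 0 j) 0 ((w2.2 j j).1 _).
    have l2v := @derive_along _ (partial j v) m (delta_mx 0 j) 0 ((v2.2 j j).1 _).
    apply: (is_derive_eq (is_deriveD (is_deriveB l2w l2v) h)).
    by rewrite scale0r add0r.
  - move=> t t1; rewrite scale0r add0r; apply: fmax; rewrite inE /=.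
    rewrite -ler_sqr ?nnegrE ?enorm_ge0 ?(ltW B0)// enorm_sqr sqnorm_line -enorm_sqr.
    have mj := le_trans (coord_le_enorm j m) mA.
    have h1 : m 0 j * t <= A * `|t|.
      by apply: (le_trans (ler_norm _)); rewrite normrM ler_wpM2r.
    have h2 : enorm m ^+ 2 <= A ^+ 2 by rewrite lerXn2r ?nnegrE ?enorm_ge0.
    have h3 : t ^+ 2 = `|t| ^+ 2 by rewrite real_normK ?num_real.
    rewrite h3 /B; have t0 : 0 <= `|t| by [].
    by move: h1 h2 t1 t0 A0; set s := `|t|; set p := enorm m ^+ 2; nra.
have : \sum_(j < 3) (partial j (partial j w) m - partial j (partial j v) m + 2 * eps) <= 0.
  by apply: sumr_le0 => j _; exact: line.
have := wg m; have := vg m; rewrite /laplacian big_split sumrB /= sumr_const card_ord => E1 E2.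
by move: E1 E2; set a1 := \sum_(_ < _) _; set a2 := \sum_(_ < _) _; lra.
Qed.

Lemma poisson_unique (g w v : 'rV[R]_3 -> R) :
  poisson_solution g w -> poisson_solution g v -> w = v.
Proof.
move=> hw hv; apply/funext => x; apply: le_anti.
by rewrite (poisson_comparison hw hv) (poisson_comparison hv hw).
Qed.
End several_variables.

(** * The time integrals solve the Poisson equation *)

Section heat_integral_poisson.
Context {R : realType}.
Implicit Types (x : 'rV[R]_3) (r : R) (n : 'I_3 -> nat) (M : nat) (j : 'I_3).
Local Notation mu := (@lebesgue_measure R).

(** The fundamental theorem of calculus on a half-line, for an integrand without a
    sign, from the version for nonnegative integrands. *)
Lemma FTC_heat (h h' : R -> R) (K C : R) :
  (forall r, -1 < r -> is_derive r 1 h (h' r)) ->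
  (forall r, 0 <= r -> {for r, continuous h'}) ->
  (forall r, 0 <= r -> `|h' r| <= K * heat_scale r ^+ 3) ->
  (forall r, 0 <= r -> `|h r| <= C * heat_scale r) ->
  \int[mu]_(r in `[0, +oo[) h' r = - h 0.
Proof.
move=> dh ch' h'K hC.
have [ih' _] := heat_dominated ch' h'K.
have K0 (r : R) : 0 <= r -> 0 <= K * heat_scale r ^+ 3.
  by move=> r0; exact: le_trans (h'K r r0).
have iK := integrable_heat_scale3 K.
(* the added term has derivative K heat_scale^3, which makes the derivative of
   the sum nonnegative *)
pose G (r : R) := h r - 2 * K * heat_scale r.
have dG r : -1 < r -> is_derive r 1 G (h' r + K * heat_scale r ^+ 3).
  move=> r1; have -> : G = h - (2 * K) *: heat_scale by [].
  apply: (is_derive_eq (is_deriveB (dh r r1) (is_deriveZ (2 * K) (is_derive_heat_scale r1)))).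
  by rewrite /GRing.scale/=; field.
have lim_h : h r @[r --> +oo] --> 0.
  apply: (@squeeze_cvgr _ _ _ _ (fun r => - (C * heat_scale r)) (fun r => C * heat_scale r)).
  - near=> r; have r0 : 0 <= r by near: r; exact: nbhs_pinfty_ge.
    by rewrite -ler_norml hC.
  - rewrite -[X in _ --> X]oppr0 -[X in - X](mulr0 C).
    by apply: cvgN; apply: cvgMr; exact: heat_scale_cvg0.
  - by rewrite -[X in _ --> X](mulr0 C); apply: cvgMr; exact: heat_scale_cvg0.
have : \int[mu]_(r in `[0, +oo[) (h' r + K * heat_scale r ^+ 3) = 0 - G 0.
  apply: Rintegral_ge0_continuous_FTC2y.
  - move=> r r0; have := h'K r r0; rewrite ler_norml => /andP[+ _]; lra.
  - apply: continuous_in_subspaceT => r; rewrite inE/= in_itv/= andbT => r0.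
    by apply: cvgD; [exact: ch'|exact: continuous_heat_scale3].
  - rewrite -[X in _ --> X](subrr 0); apply: cvgB => //.
    by rewrite -[X in _ --> X](mulr0 (2 * K)); apply: cvgMr; exact: heat_scale_cvg0.
  - by move=> r r0; have [] := dG r (ltac:(lra)).
  - by apply: cvg_at_right_derivable; apply: dG; lra.
  - by move=> r; rewrite in_itv/= andbT => r0; rewrite derive1E; apply: derive_val; apply: dG; lra.
rewrite RintegralD// Rintegral_heat_scale3 /G heat_scale0; lra.
Unshelve. all: by end_near. Qed.

Lemma is_derive_heat_prod_time M n x r : -1 < r ->
  is_derive r 1 (heat_prod M n x)
    (4^-1 * \sum_(j < 3) heat_prod M (incr (incr n j) j) x r).
Proof.
move=> r1.
have d j := heat_equation_eta M (n j) (x 0 j) r1.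
have -> : heat_prod M n x = heat_eta M (n 0) (x 0 0) * heat_eta M (n 1) (x 0 1)
    * heat_eta M (n ord_max) (x 0 ord_max).
  by apply/funext => s; rewrite /heat_prod prod3E.
apply: (is_derive_eq (is_deriveM (is_deriveM (d 0) (d 1)) (d ord_max))).
rewrite sum3E /heat_prod !prod3E.
by rewrite /incr /= !addn0 !addn1 /GRing.scale/= fctE; ring.
Qed.

(** The sum over j is 4 d/dr of the integrand by the heat equation, so that only the
    value at r = 0 survives. *)
Lemma laplacian_heat_integral M n x :
  \sum_(j < 3) heat_integral M (incr (incr n j) j) x = - 4 * heat_prod M n x 0.
Proof.
have /all_sig2[K K0 hK] := fun j => cid2 (@heat_prod_bound R M (incr (incr n j) j)).
have [C C0 hC] := @heat_prod_bound R M n.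
have i_j j := @integrable_heat_prod R M (incr (incr n j) j) x.
have cj j r : 0 <= r -> {for r, continuous (heat_prod M (incr (incr n j) j) x)}.
  by move=> r0; exact: continuous_heat_prod.
have intsum : \int[mu]_(r in `[0, +oo[) (4^-1 * \sum_(j < 3) heat_prod M (incr (incr n j) j) x r)
    = 4^-1 * \sum_(j < 3) heat_integral M (incr (incr n j) j) x.
  under eq_Rintegral do rewrite sum3E.
  rewrite RintegralZl//; last by do 2 apply: integrable_add => //.
  rewrite RintegralD//; last by apply: integrable_add.
  by rewrite RintegralD// sum3E.
have := @FTC_heat (heat_prod M n x) (fun r => 4^-1 * \sum_(j < 3) heat_prod M (incr (incr n j) j) x r)
   (4^-1 * \sum_j K j) C (@is_derive_heat_prod_time M n x).
rewrite intsum => /(_ _ _ _)/= H.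
have {}H : 4^-1 * \sum_(j < 3) heat_integral M (incr (incr n j) j) x = - heat_prod M n x 0.
  apply: H => r r0.
  - apply: cvgM; first exact: cvg_cst.
    under eq_fun do rewrite sum3E.
    by rewrite sum3E; apply: cvgD; [apply: cvgD|]; exact: cj.
  - rewrite normrM ger0_norm// -mulrA ler_wpM2l// (le_trans (ler_norm_sum _ _ _))//.
    by rewrite mulr_suml ler_sum// => j _; exact: hK.
  - apply: (le_trans (hC x r r0)); rewrite ler_wpM2l// -[leRHS]expr1.
    by rewrite ler_wiXn2l ?heat_scale_ge0 ?heat_scale_le1.
by lra.
Qed.

Lemma partial_heat_integral M n j (c : R) :
  partial j (fun x => c * heat_integral M n x) = (fun x => c * heat_integral M (incr n j) x).
Proof.
apply/funext => x; apply: derive_val.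
exact: (is_deriveZ c (is_derive_heat_integral M n x j)).
Qed.

Lemma derivable_heat_integral M n j (c : R) x :
  derivable (fun x => c * heat_integral M n x) x (delta_mx 0 j).
Proof. by have [] := is_deriveZ c (is_derive_heat_integral M n x j). Qed.

(** The partial derivatives are again heat integrals, hence bounded. *)
Lemma continuous_heat_integral M n (c : R) :
  continuous (fun x => c * heat_integral M n x).
Proof.
apply: continuous_bounded_partials => [j x|x]; first exact: derivable_heat_integral.
have /all_sig2[K K0 hK] := fun j => cid2 (@heat_integral_bound R M (incr n j)).
exists (\sum_(j < 3) `|c| * K j); apply: (@filterE _ _ (nbhs_filter x)) => y j.
rewrite partial_heat_integral normrM (bigD1 j)//=.
rewrite (le_trans (ler_wpM2l _ (hK j y)))// lerDl; apply: sumr_ge0 => k _.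
by rewrite mulr_ge0.
Qed.

Lemma classC2_heat_integral M n (c : R) : classC2 (fun x => c * heat_integral M n x).
Proof.
have C1 n' : classC1 (fun x => c * heat_integral M n' x).
  move=> j; split=> [x|]; first exact: derivable_heat_integral.
  by rewrite partial_heat_integral; exact: continuous_heat_integral.
by split=> // j; rewrite partial_heat_integral; exact: C1.
Qed.

(** A derivative has brought a fourth power of heat_scale.  Giving up one of these
    powers for a factor |x j| keeps the integrand dominated, so that |x| times the
    function is bounded. *)
Lemma heat_integral_vanishes M i (c : R) :
  vanishes_at_infinity (fun x => c * heat_integral M (incr (fun=> 0%N) i) x).
Proof.
set n := incr _ i.
have /all_sig2[D D0 hD] := fun j => cid2 (@heat_eta_bound R M (n j)).
pose C := \prod_(j < 3) D j.
have C0 : 0 <= C by apply: prodr_ge0.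
have decay j x : `|x 0 j| * `|heat_integral M n x| <= C * 2.
  pose f r := x 0 j * heat_prod M n x r.
  have cf r : 0 <= r -> {for r, continuous f}.
    by move=> r0; apply: cvgM; [exact: cvg_cst|exact: continuous_heat_prod].
  have fC r : 0 <= r -> `|f r| <= C * heat_scale r ^+ 3.
    move=> r0; have w0 := heat_scale_ge0 r; have w1 := heat_scale_le1 r0.
    have -> : f r = \prod_(k < 3) ((if k == j then x 0 k else 1) * heat_eta M (n k) (x 0 k) r).
      by rewrite big_split -big_mkcond /= big_pred1_eq.
    rewrite normr_prod.
    (* the exponents n k sum up to 1, and the two factors other than the j-th add
       one each *)
    have -> : C * heat_scale r ^+ 3 = \prod_(k < 3) (D k * heat_scale r ^+ (n k + (k != j))).
      rewrite big_split /= prodrXr; congr (_ * _ ^+ _); rewrite /n /incr.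
      rewrite !big_ord_recr big_ord0 /=.
      by case: (i) => [[|[|[|//]]] ?]; case: (j) => [[|[|[|//]]] ?].
    apply: ler_prod => k _; rewrite normr_ge0 /=; have [h1 h2] := hD k (x 0 k) r r0.
    by case: eqP => _; rewrite ?addn0 ?addn1 ?mul1r.
  have [i_f] := heat_dominated cf fC.
  by rewrite /f RintegralZl ?normrM//; exact: integrable_heat_prod.
have sum_decay x : enorm x * `|heat_integral M n x| <= 3 * (C * 2).
  have h : enorm x <= \sum_(j < 3) `|x 0 j|.
    rewrite -ler_sqr ?nnegrE ?enorm_ge0 ?sumr_ge0// enorm_sqr.
    rewrite !sum3E -!(real_normK (num_real (x 0 _))).
    have := normr_ge0 (x 0 0); have := normr_ge0 (x 0 1); have := normr_ge0 (x 0 ord_max).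
    set a := `|_|; set b := `|_|; set d := `|_| => a0 b0 d0.
    have := mulr_ge0 a0 b0; have := mulr_ge0 a0 d0; have := mulr_ge0 b0 d0.
    by nra.
  apply: le_trans (ler_wpM2r _ h) _ => //.
  rewrite mulr_suml (_ : 3 * (C * 2) = \sum_(j < 3) (C * 2)); last first.
    by rewrite sumr_const card_ord mulr_natl.
  by apply: ler_sum => j _; exact: decay.
move=> e e0; exists (`|c| * (3 * (C * 2)) / e) => x hx.
have x0 : 0 < enorm x by apply: le_lt_trans hx; rewrite divr_ge0 ?mulr_ge0// ltW.
rewrite normrM -(ltr_pM2l x0) mulrCA.
apply: le_lt_trans (ler_wpM2l _ (sum_decay x)) _ => //.
by rewrite -ltr_pdivrMr.
Qed.
End heat_integral_poisson.

(** * The time integral of the heat kernel *)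

Section newton_kernel.
Context {R : realType}.
Implicit Types (x z r : R).
Local Notation mu := (@lebesgue_measure R).

(** Up to the factor sqrt pi, the one-dimensional heat kernel at time r/4.  As
    1 / sqrt r = 0 for r <= 0, it vanishes for r <= 0, and integrals over time can be
    taken over the whole line. *)
Definition heat_kernel z r : R := inv_sqrt r * gauss_fun (z * inv_sqrt r).

Lemma heat_kernel_ge0 z r : 0 <= heat_kernel z r.
Proof. by rewrite mulr_ge0 ?inv_sqrt_ge0 ?gauss_fun_ge0. Qed.

Lemma heat_kernel_le0 z r : r <= 0 -> heat_kernel z r = 0.
Proof. by move=> r0; rewrite /heat_kernel inv_sqrt_le0// mul0r. Qed.

(** Inversion is not continuous at 0, but on nonnegative reals it is the power -1. *)
Lemma measurable_inv_sqrt : measurable_fun setT (@inv_sqrt R).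
Proof.
have -> : @inv_sqrt R = (fun y => y `^ (-1)) \o Num.sqrt.
  by apply/funext => r; rewrite /inv_sqrt /= powR_inv1 ?sqrtr_ge0.
apply: measurableT_comp; first exact: measurable_powR.
by apply: continuous_measurable_fun; exact: sqrt_continuous.
Qed.

Lemma measurable_heat_kernel d (T : measurableType d) (f g : T -> R) :
  measurable_fun setT f -> measurable_fun setT g ->
  measurable_fun setT (fun t => heat_kernel (f t) (g t)).
Proof.
move=> mf mg; have mi : measurable_fun setT (fun t => inv_sqrt (g t)).
  exact: (measurableT_comp measurable_inv_sqrt mg).
apply: measurable_funM => //; apply: (measurableT_comp measurable_gauss_fun).
exact: measurable_funM.
Qed.

Local Notation gauss_primitive := (@gauss_integral_proof.integral0_gauss R).

Lemma gauss_primitive_derive z : 0 < z -> is_derive z 1 gauss_primitive (gauss_fun z).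
Proof.
move=> z0.
have zz : z < z + 1 by lra.
have ig : mu.-integrable `[0, z + 1] (EFin \o @gauss_fun R).
  by apply: integrableS (@integrableT_gauss R).
have [d1 d2] := continuous_FTC1_closed zz ig z0 (@continuous_gauss_fun R z).
by apply: DeriveDef; [exact: d1|rewrite -derive1E].
Qed.

(** The square of this primitive is known to tend to pi / 4. *)
Lemma gauss_primitive_cvgy : gauss_primitive z @[z --> +oo] --> Num.sqrt pi / 2.
Proof.
have : Num.sqrt (gauss_primitive z ^+ 2) @[z --> +oo] --> Num.sqrt (pi / 4).
  apply: continuous_cvg; first exact: sqrt_continuous.
  exact: gauss_integral_proof.cvg_integral0_gauss_sqr.
have -> : Num.sqrt (pi / 4) = Num.sqrt pi / 2 :> R.
  by rewrite sqrtrM ?pi_ge0// sqrtrV// (_ : 4 = 2 ^+ 2) ?sqrtr_sqr ?ger0_norm// -natrX.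
apply: cvg_trans; apply: near_eq_cvg; apply: nearW => z.
by rewrite sqrtr_sqr ger0_norm// gauss_integral_proof.integral0_gauss_ge0.
Qed.

Lemma gauss_primitive_le z : 0 <= z -> gauss_primitive z <= z.
Proof.
move=> z0; have {2}-> : z = \int[mu]_(t in `[0, z]) cst 1 t.
  rewrite Rintegral_cst//= lebesgue_measure_itv/= lte_fin.
  case: ltP => h; rewrite /= ?oppr0 ?addr0 ?mul1r ?mulr0//.
  by apply/eqP; rewrite eq_le h z0.
apply: le_Rintegral => //.
- by apply: integrableS (@integrableT_gauss R).
- apply: continuous_compact_integrable; first exact: segment_compact.
  by apply: continuous_subspaceT => y; exact: cvg_cst.
- by move=> t _; exact: gauss_fun_le1.
Qed.

(** The change of variables q = 1 / sqrt r reduces the integral to that of the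
    Gaussian over the half-line.  It is carried out through the primitive
    - (2 / z) gauss_primitive (z / sqrt r). *)
Lemma integral_inv_sqrt3_gauss z : 0 < z ->
  (\int[mu]_(r in `[0%R, +oo[) (inv_sqrt r ^+ 3 * gauss_fun (z * inv_sqrt r))%:E =
   (Num.sqrt pi / z)%:E)%E.
Proof.
move=> z0.
pose f r := inv_sqrt r ^+ 3 * gauss_fun (z * inv_sqrt r).
(* at r = 0 the formula with 1 / sqrt r = 0 would give 0 instead of the limit *)
pose F r := if r <= 0 then - (Num.sqrt pi / z) else - (2 / z) * gauss_primitive (z * inv_sqrt r).
have dF r : 0 < r -> is_derive r 1 F (f r).
  move=> r0.
  have d1 : is_derive r 1 (fun s => z * inv_sqrt s) (z * (- 2^-1 * inv_sqrt r ^+ 3)).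
    exact: (is_deriveZ z (is_derive_inv_sqrt r0)).
  have d2 := is_derive1_comp (f := gauss_primitive) (g := fun s => z * inv_sqrt s)
    (gauss_primitive_derive (mulr_gt0 z0 (inv_sqrt_gt0 r0))) d1.
  have := is_deriveZ (- (2 / z)) d2.
  move/(@near_eq_is_derive _ _ _ _ F) => d3.
  apply: (is_derive_eq (d3 _)).
  - near=> s; rewrite /F ifF// leNgt; apply/negbTE/negPn.
    by near: s; exact: lt_nbhsr.
  - by rewrite /f /GRing.scale/=; field; rewrite gt_eqF.
have Flim : F r @[r --> 0^'+] --> F 0.
  rewrite {2}/F lexx.
  have -> : - (Num.sqrt pi / z) = - (2 / z) * (Num.sqrt pi / 2) :> R by field; rewrite gt_eqF.
  have c : - (2 / z) * gauss_primitive (z * inv_sqrt r) @[r --> 0^'+] --> - (2 / z) * (Num.sqrt pi / 2).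
    apply: cvgMr; apply: cvg_comp gauss_primitive_cvgy.
    by apply: gt0_cvgMry => //; exact: inv_sqrt_cvgy.
  apply: cvg_trans c; apply: near_eq_cvg; near=> r.
  by rewrite /F ifF// leNgt; apply/negbTE/negPn.
have Fy : F r @[r --> +oo] --> 0.
  have c : - (2 / z) * gauss_primitive (z * inv_sqrt r) @[r --> +oo] --> 0.
    apply: (@squeeze_cvgr _ _ _ _ (fun r => -2 * inv_sqrt r) (cst 0)).
    - apply: nearW => r; have q0 := inv_sqrt_ge0 r.
      have zq : 0 <= z * inv_sqrt r by rewrite mulr_ge0// ltW.
      have e1 := gauss_primitive_le zq; have e0 := gauss_integral_proof.integral0_gauss_ge0 (z * inv_sqrt r).
      rewrite !mulNr lerN2 oppr_le0 mulr_ge0 ?divr_ge0 ?(ltW z0)//= andbT.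
      rewrite (_ : 2 * inv_sqrt r = 2 / z * (z * inv_sqrt r)); last by field; rewrite gt_eqF.
      by rewrite ler_wpM2l// divr_ge0// ltW.
    - rewrite -[X in _ --> X](mulr0 (-2)); apply: cvgMr; exact: inv_sqrt_cvg0.
    - exact: cvg_cst.
  apply: cvg_trans c; apply: near_eq_cvg; near=> r.
  rewrite /F ifF// leNgt; apply/negbTE/negPn.
  by near: r; apply: nbhs_pinfty_gt; rewrite num_real.
rewrite (@ge0_continuous_FTC2y _ f F 0 0) //.
- by rewrite sub0e /F lexx -EFinN opprK.
- by move=> r _; rewrite mulr_ge0 ?exprn_ge0 ?inv_sqrt_ge0 ?gauss_fun_ge0.
- apply/continuous_within_itvcyP; split.
    move=> r; rewrite in_itv/= andbT => r0.
    have c := is_derive_continuous (is_derive_inv_sqrt r0).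
    apply: cvgM.
      apply: (cvg_comp inv_sqrt (fun y => y ^+ 3)); first exact: c.
      exact: exprn_continuous.
    by apply: continuous_comp; [apply: cvgMr; exact: c|exact: continuous_gauss_fun].
  (* boundedness of y^4 e^(-y^2) at y = z / sqrt r gives f r <= C z^(-4) sqrt r *)
  have [C C0 hC] := poly_gauss_bounded ('X^4 : {poly R}).
  have f0 : f 0 = 0 by rewrite /f inv_sqrt_le0// expr0n/= mul0r.
  rewrite f0; apply: (@squeeze_cvgr _ _ _ _ (cst 0) (fun r => C / z ^+ 4 * Num.sqrt r)).
  + near=> r; rewrite /f mulr_ge0 ?exprn_ge0 ?inv_sqrt_ge0 ?gauss_fun_ge0//=.
    have r0 : 0 < r by [].
    have s0 : 0 < Num.sqrt r by rewrite sqrtr_gt0.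
    rewrite -[Num.sqrt r]invrK -/(inv_sqrt r).
    have q0 := inv_sqrt_gt0 r0.
    rewrite ler_pdivlMr// mulrAC ler_pdivlMr ?exprn_gt0//.
    have := hC (z * inv_sqrt r); rewrite hornerXn ger0_norm; last first.
      by rewrite mulr_ge0 ?gauss_fun_ge0// exprn_ge0// mulr_ge0// ltW.
    apply: le_trans; set g := gauss_fun _; set q := inv_sqrt r.
    by rewrite (_ : (z * q) ^+ 4 * g = q ^+ 3 * q * g * z ^+ 4)//; ring.
  + exact: cvg_cst.
  + rewrite -[X in _ --> X](mulr0 (C / z ^+ 4)); apply: cvgMr.
    by rewrite -[X in _ --> X]sqrtr0; apply: cvg_at_right_filter; exact: sqrt_continuous.
- by move=> r r0; have [] := dF r r0.
- by move=> r; rewrite in_itv/= andbT => r0; rewrite derive1E; apply: derive_val; exact: dF.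
Unshelve. all: by end_near. Qed.

End newton_kernel.

(** * Convolution with the heat kernel *)

Section gaussian_convolution.
Context {R : realType}.
Implicit Types (x y a b r : R) (n M : nat).
Local Notation mu := (@lebesgue_measure R).

Lemma normal_pdf_variance (m v y : R) : 0 < v ->
  normal_pdf m (Num.sqrt (v / 2)) y = (Num.sqrt (v * pi))^-1 * expR (- ((y - m) ^+ 2 / v)).
Proof.
move=> v0; have v2 : 0 < v / 2 by rewrite divr_gt0.
rewrite normal_pdfE ?sqrtr_eq0 -?ltNge// /normal_peak /normal_fun sqr_sqrtr ?ltW//.
have v22 : v / 2 *+ 2 = v by rewrite -[_ *+ 2]mulr_natr divfK.
by rewrite -mulrnAl v22 mulNr.
Qed.

Lemma heat_kernel_normal x y r : 0 < r ->
  heat_kernel (x - y) r = Num.sqrt pi * normal_pdf x (Num.sqrt (r / 2)) y.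
Proof.
move=> r0; rewrite normal_pdf_variance// /heat_kernel /gauss_fun exprMn inv_sqrtX2//.
rewrite -[in RHS]sqrrN opprB sqrtrM ?ltW// -/(inv_sqrt r) /inv_sqrt.
have s0 : Num.sqrt r != 0 by rewrite sqrtr_eq0 -ltNge.
have p0 : Num.sqrt pi != 0 :> R by rewrite sqrtr_eq0 -ltNge pi_gt0.
by field; rewrite p0 s0.
Qed.

Lemma integrable_heat_kernel x r : 0 < r ->
  mu.-integrable setT (EFin \o (fun y => heat_kernel (x - y) r)).
Proof.
move=> r0; under eq_fun do rewrite (heat_kernel_normal _ _ r0).
exact/integrable_scale/integrable_normal_pdf.
Qed.

(** Completing the square: the exponents add up to that of a normal density in y,
    with variance b r / (2 (b + r)), and a factor independent of y. *)
Lemma gauss_conv_normal x y a b r : 0 < b -> 0 < r ->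
  expR (- ((y - a) ^+ 2 / b)) * heat_kernel (x - y) r =
  (Num.sqrt (pi * b / (b + r)) * expR (- ((x - a) ^+ 2 / (b + r))))
    * normal_pdf ((r * a + b * x) / (b + r)) (Num.sqrt ((b * r / (b + r)) / 2)) y.
Proof.
move=> b0 r0; have br0 : 0 < b + r by rewrite addr_gt0.
have v0 : 0 < b * r / (b + r) by rewrite divr_gt0// mulr_gt0.
rewrite normal_pdf_variance// /heat_kernel /gauss_fun exprMn inv_sqrtX2//.
have pb0 : 0 < pi * b / (b + r) by rewrite divr_gt0// mulr_gt0// pi_gt0.
have -> : Num.sqrt (b * r / (b + r) * pi) = Num.sqrt r * Num.sqrt (pi * b / (b + r)).
  by rewrite -sqrtrM ?ltW//; congr Num.sqrt; field; rewrite gt_eqF.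
have s0 : Num.sqrt r != 0 by rewrite sqrtr_eq0 -ltNge.
have p0 : Num.sqrt (pi * b / (b + r)) != 0 by rewrite sqrtr_eq0 -ltNge.
rewrite /inv_sqrt; set p := Num.sqrt (pi * b / _) in p0 *; set q := Num.sqrt r in s0 *.
rewrite mulrCA -expRD.
set C := - ((x - a) ^+ 2 / (b + r)); set D := - (_ / (b * r / (b + r))).
have -> : p * expR C * ((q * p)^-1 * expR D) = q^-1 * expR (C + D).
  by rewrite expRD; field; rewrite s0 p0.
congr (_ * expR _); rewrite /C /D; field.
by rewrite !gt_eqF.
Qed.

Lemma integrable_gauss_conv x a b r : 0 < b -> 0 < r ->
  mu.-integrable setT (EFin \o (fun y => expR (- ((y - a) ^+ 2 / b)) * heat_kernel (x - y) r)).
Proof.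
move=> b0 r0; under eq_fun do rewrite (gauss_conv_normal _ _ _ b0 r0).
exact/integrable_scale/integrable_normal_pdf.
Qed.

Lemma integral_gauss_conv x a b r : 0 < b -> 0 < r ->
  \int[mu]_y (expR (- ((y - a) ^+ 2 / b)) * heat_kernel (x - y) r) =
  Num.sqrt (pi * b / (b + r)) * expR (- ((x - a) ^+ 2 / (b + r))).
Proof.
move=> b0 r0; under eq_Rintegral do rewrite (gauss_conv_normal _ _ _ b0 r0).
rewrite RintegralZl//; last exact: integrable_normal_pdf.
by rewrite /Rintegral integral_normal_pdf mulr1.
Qed.

Lemma continuous_heat_gauss n r : continuous (fun x => heat_gauss n x r).
Proof. by move=> x; exact: is_derive_continuous (is_derive_heat_gauss n x r). Qed.

Lemma measurable_heat_gauss_conv n x a r : measurable_fun setT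
  (fun y => heat_gauss n (y - a) 0 * heat_kernel (x - y) r).
Proof.
have mh : measurable_fun setT (fun y => heat_gauss n y 0).
  by apply: continuous_measurable_fun; exact: continuous_heat_gauss.
have ms : measurable_fun setT (fun y => y - a) by exact: measurable_funB.
apply: measurable_funM; first exact: (measurableT_comp mh ms).
by apply: measurable_heat_kernel => //; exact: measurable_funB.
Qed.

Lemma heat_gauss_conv_bound n x r : exists2 C : R, 0 <= C & forall a y : R,
  `|heat_gauss n (y - a) 0 * heat_kernel (x - y) r| <= C * heat_kernel (x - y) r.
Proof.
have [C C0 hC] := @heat_gauss_bound R n; exists C => // a' y'.
rewrite normrM (ger0_norm (heat_kernel_ge0 _ _)) ler_wpM2r ?heat_kernel_ge0//.
by have [] := hC (y' - a') 0 (lexx 0); rewrite heat_scale0 expr1n mulr1.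
Qed.

Lemma integrable_heat_gauss_conv n x a r : 0 < r -> mu.-integrable setT
  (EFin \o (fun y => heat_gauss n (y - a) 0 * heat_kernel (x - y) r)).
Proof.
move=> r0; have [C C0 hC] := heat_gauss_conv_bound n x r.
have iK : mu.-integrable setT (EFin \o (fun y => C * heat_kernel (x - y) r)).
  exact/integrable_scale/integrable_heat_kernel.
apply: le_integrable iK => //.
  by apply/measurable_EFinP; exact: measurable_heat_gauss_conv.
by move=> y _ /=; rewrite lee_fin (le_trans (hC a y))// ler_norm.
Qed.

(** For n = 0 this is the convolution of two Gaussians.  A derivative in the shift a
    raises n by one on both sides, which gives the induction step. *)
Lemma heat_gauss_conv n x a r : 0 < r ->
  \int[mu]_y (heat_gauss n (y - a) 0 * heat_kernel (x - y) r) =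
  Num.sqrt pi * heat_gauss n (x - a) r.
Proof.
move=> r0; elim: n a => [|n IH] a.
  have r1 : -1 < r by lra.
  have E z s : -1 < s -> heat_gauss 0 z s = heat_scale s * expR (- (z ^+ 2 / (1 + s))).
    by move=> s1; rewrite /heat_gauss gauss_poly0 hornerC mul1r expr1 gauss_fun_scale.
  have -> : (fun y => heat_gauss 0 (y - a) 0 * heat_kernel (x - y) r) =
      (fun y => expR (- ((y - a) ^+ 2 / 1)) * heat_kernel (x - y) r).
    by apply/funext => y; rewrite E ?addr0 ?heat_scale0 ?mul1r//; lra.
  rewrite integral_gauss_conv// E// mulr1 sqrtrM ?pi_ge0// mulrA; congr (_ * _ * _).
  by rewrite /heat_scale /inv_sqrt sqrtrV//; lra.
have [C C0 hC] := heat_gauss_conv_bound n.+1 x r.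
have d y (s : R) : is_derive s 1 (fun a => heat_gauss n (y - a) 0) (- heat_gauss n.+1 (y - s) 0).
  have h : is_derive s 1 (fun a => y - a) (- 1).
    apply: (is_derive_eq (is_deriveB (is_derive_cst y s 1) (is_derive_id s 1))).
    by rewrite sub0r.
  have := is_derive1_comp (f := heat_gauss n ^~ 0) (g := fun a => y - a)
    (is_derive_heat_gauss n (y - s) 0) h.
  by rewrite mulrN1.
have dL : is_derive a 1
    (fun s => \int[mu]_y (heat_gauss n (y - s) 0 * heat_kernel (x - y) r))
    (\int[mu]_y (- heat_gauss n.+1 (y - a) 0 * heat_kernel (x - y) r)).
  pose f s y := heat_gauss n (y - s) 0 * heat_kernel (x - y) r.
  pose f' s y := - heat_gauss n.+1 (y - s) 0 * heat_kernel (x - y) r.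
  have iG := integrable_scale C measurableT (integrable_heat_kernel x r0).
  have H := @is_derive_under_integral R _ _ mu f f' setT
    (fun y => C * heat_kernel (x - y) r) a _ _ _ _ iG _.
  apply: H => //.
  - by move=> s; exact: integrable_heat_gauss_conv.
  - move=> s y _; rewrite /f /f' mulrC.
    have -> : (fun s => heat_gauss n (y - s) 0 * heat_kernel (x - y) r) =
        heat_kernel (x - y) r *: (fun s => heat_gauss n (y - s) 0).
      by apply/funext => s'; rewrite mulrC.
    exact: (is_deriveZ _ (d y s)).
  - by move=> y; rewrite mulr_ge0 ?heat_kernel_ge0.
  - by move=> s y _; rewrite /f' mulNr normrN; exact: hC.
have dR : is_derive a 1 (fun s => Num.sqrt pi * heat_gauss n (x - s) r)
    (Num.sqrt pi * - heat_gauss n.+1 (x - a) r).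
  have h : is_derive a 1 (fun s => x - s) (- 1).
    apply: (is_derive_eq (is_deriveB (is_derive_cst x a 1) (is_derive_id a 1))).
    by rewrite sub0r.
  have := is_derive1_comp (f := heat_gauss n ^~ r) (g := fun s => x - s)
    (is_derive_heat_gauss n (x - a) r) h.
  by rewrite mulrN1 => h2; exact: (is_deriveZ (Num.sqrt pi) h2).
have E : (fun s => \int[mu]_y (heat_gauss n (y - s) 0 * heat_kernel (x - y) r)) =
    (fun s => Num.sqrt pi * heat_gauss n (x - s) r) by apply/funext.
rewrite E in dL.
have := @derive_val _ _ _ _ _ _ _ dL; rewrite (@derive_val _ _ _ _ _ _ _ dR).
under eq_Rintegral do rewrite -mulN1r -mulrA.
rewrite RintegralZl//; last exact: integrable_heat_gauss_conv.
by rewrite mulN1r mulrN => /oppr_inj ->.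
Qed.

Lemma integral_sum_seq (I : Type) (s : seq I) (f : I -> R -> R) :
  (forall i, mu.-integrable setT (EFin \o f i)) ->
  mu.-integrable setT (EFin \o (fun y => \sum_(i <- s) f i y)) /\
  \int[mu]_y (\sum_(i <- s) f i y) = \sum_(i <- s) \int[mu]_y f i y.
Proof.
move=> i_f; elim: s => [|i s [IH1 IH2]].
  split.
    by under eq_fun do rewrite big_nil; exact: integrable0.
  under eq_Rintegral do rewrite big_nil.
  by rewrite big_nil Rintegral_cst//= mul0r.
split; first by under eq_fun do rewrite big_cons; exact: integrable_add.
under eq_Rintegral do rewrite big_cons.
by rewrite big_cons RintegralD// IH2.
Qed.

Lemma eta_conv M x r : (1 <= M)%N -> 0 < r ->
  mu.-integrable setT (EFin \o (fun y => Defs.eta M y * heat_kernel (x - y) r)) /\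
  \int[mu]_y (Defs.eta M y * heat_kernel (x - y) r) = heat_eta M 0 x r.
Proof.
move=> M1 r0.
pose f (k : 'I_M) y := (Num.sqrt pi)^-1 * eta_coef k *
  (heat_gauss (2 * k + 0) (y - 0) 0 * heat_kernel (x - y) r).
have E : (fun y => Defs.eta M y * heat_kernel (x - y) r) = (fun y => \sum_(k < M) f k y).
  apply/funext => y; rewrite eta_heat_eta// /heat_eta -mulrA mulr_suml mulr_sumr.
  by apply: eq_bigr => k _; rewrite /f subr0 !mulrA.
have i_f k : mu.-integrable setT (EFin \o f k).
  by apply: integrable_scale => //; exact: integrable_heat_gauss_conv.
have [I1 I2] := integral_sum_seq (index_enum 'I_M) i_f.
split; first by rewrite E.
rewrite E I2 /heat_eta; apply: eq_bigr => k _.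
rewrite /f RintegralZl//; last exact: integrable_heat_gauss_conv.
rewrite heat_gauss_conv// subr0; field.
by rewrite sqrtr_eq0 -ltNge pi_gt0.
Qed.

(** The Gaussian e^(-y^2/2) is wider than that of eta, so that it absorbs the
    polynomial, and its convolution with the heat kernel is still explicit. *)
Lemma eta_bound M : (1 <= M)%N -> exists2 C : R, 0 <= C &
  forall y, `|Defs.eta M y| <= C * expR (- (y ^+ 2 / 2)).
Proof.
move=> M1; have B k := cid2 (poly_gauss_bound (gauss_poly k : {poly R})).
pose D k := sval (B k).
have D0 k : 0 <= D k by rewrite /D; case: (B _).
have DP k y : `|(gauss_poly k).[y] * gauss_fun y| <= D k * expR (- (y ^+ 2 / 2)).
  by rewrite /D; case: (B _).
exists ((Num.sqrt pi)^-1 * \sum_(k < M) `|eta_coef k| * D (2 * k + 0)%N).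
  by rewrite mulr_ge0 ?invr_ge0 ?sqrtr_ge0// sumr_ge0// => k _; rewrite mulr_ge0.
move=> y; rewrite eta_heat_eta// normrM ger0_norm ?invr_ge0 ?sqrtr_ge0// -mulrA.
rewrite ler_wpM2l ?invr_ge0 ?sqrtr_ge0// mulr_suml.
apply: (le_trans (ler_norm_sum _ _ _)); apply: ler_sum => k _.
by rewrite normrM -mulrA ler_wpM2l// /heat_gauss heat_scale0 expr1n mul1r mulr1 DP.
Qed.

Lemma continuous_eta M : (1 <= M)%N -> continuous (@Defs.eta R M).
Proof.
move=> M1; have -> : @Defs.eta R M = (fun y => (Num.sqrt pi)^-1 * heat_eta M 0 y 0).
  by apply/funext => y; rewrite eta_heat_eta.
by move=> y; apply: cvgMr; exact: is_derive_continuous (is_derive_heat_eta M 0 y 0).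
Qed.
End gaussian_convolution.

(** * Product measures *)

Section product_integrals.
Context {R : realType} d1 d2 (T1 : measurableType d1) (T2 : measurableType d2).
Context (m1 : {sigma_finite_measure set T1 -> \bar R})
        (m2 : {sigma_finite_measure set T2 -> \bar R}).

Lemma integrable_prodM (f : T1 -> R) (g : T2 -> R) :
  m1.-integrable setT (EFin \o f) -> m2.-integrable setT (EFin \o g) ->
  (m1 \x m2)%E.-integrable setT (EFin \o (fun p => f p.1 * g p.2)) /\
  \int[(m1 \x m2)%E]_p (f p.1 * g p.2) = (\int[m1]_x f x) * (\int[m2]_y g y).
Proof.
move=> i_f i_g.
pose fg (p : T1 * T2) := f p.1 * g p.2.
have mf := measurable_int _ i_f; have mg := measurable_int _ i_g.
have mfg : measurable_fun setT (EFin \o (fun p : T1 * T2 => f p.1 * g p.2)).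
  apply/measurable_EFinP; apply: measurable_funM.
    by apply: measurableT_comp => //; exact/measurable_EFinP.
  by apply: measurableT_comp => //; exact/measurable_EFinP.
have ifg : (m1 \x m2)%E.-integrable setT (EFin \o (fun p => f p.1 * g p.2)).
  apply/(integrable12ltyP _ _ mfg).
  have nf := integrable_norm i_f; have ng := integrable_norm i_g.
  have E x : (\int[m2]_y `|(EFin \o fg) (x, y)| =
      (`|f x| * \int[m2]_y `|g y|)%R%:E)%E.
    rewrite (eq_integral (fun y => (`|f x|%R)%:E * (`|g y|%R)%:E)%E); last first.
      by move=> y _; rewrite /fg /= normrM EFinM.
    rewrite (integralZl measurableT ng).
    by rewrite EFinM /Rintegral fineK//; exact: integrable_fin_num ng.
  under eq_integral do rewrite E mulrC EFinM.
  rewrite (integralZl measurableT nf).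
  by rewrite -(fineK (integrable_fin_num measurableT nf)) -EFinM ltry.
split=> //.
rewrite [LHS]/Rintegral -(integral12_prod_meas1 ifg) /fubini_F.
have E x : (\int[m2]_y (EFin \o fg) (x, y) =
    (f x * \int[m2]_y g y)%R%:E)%E.
  rewrite (eq_integral (fun y => (f x)%:E * (g y)%:E)%E) => [|y _]; last by rewrite /fg /= EFinM.
  rewrite (integralZl measurableT i_g).
  by rewrite EFinM /Rintegral fineK//; exact: integrable_fin_num i_g.
rewrite (eq_integral (fun x => ((\int[m2]_y g y) * f x)%R%:E)) => [|x _]; last first.
  by rewrite mulrC; exact: E.
by rewrite -/(Rintegral m1 setT (fun x => (\int[m2]_y g y) * f x)) RintegralZl// mulrC.
Qed.
End product_integrals.

Lemma sigma_finite_prod {R : realType} d1 d2 (T1 : measurableType d1) (T2 : measurableType d2)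
  (m1 : {sigma_finite_measure set T1 -> \bar R}) (m2 : {sigma_finite_measure set T2 -> \bar R}) :
  sigma_finite setT (m1 \x m2)%E.
Proof.
have /sigma_finiteP[F [FT ndF finF]] := sigma_finiteT m1.
have /sigma_finiteP[G [GT ndG finG]] := sigma_finiteT m2.
exists (fun n => F n `*` G n) => [|n].
  apply/esym/seteqP; split=> // -[u v] _.
  have [k _ Fk] : (\bigcup_n F n) u by rewrite -FT.
  have [l _ Gl] : (\bigcup_n G n) v by rewrite -GT.
  exists (maxn k l) => //; split.
    by move/subsetPset: (ndF _ _ (leq_maxl k l)); apply.
  by move/subsetPset: (ndG _ _ (leq_maxr k l)); apply.
have [mF fF] := finF n; have [mG fG] := finG n.
split; first exact: measurableX.
by rewrite product_measure1E// lte_mul_pinfty// ge0_fin_numE.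
Qed.

(** Named so that a sigma-finite structure can be attached to it. *)
Definition lebesgue2 {R : realType} : set (measurableTypeR R * measurableTypeR R) -> \bar R :=
  (@lebesgue_measure R \x @lebesgue_measure R)%E.
HB.instance Definition _ (R : realType) := Measure.on (@lebesgue2 R).
HB.instance Definition _ (R : realType) :=
  Measure_isSigmaFinite.Build _ _ R (@lebesgue2 R)
    (sigma_finite_prod (@lebesgue_measure R) (@lebesgue_measure R)).

HB.instance Definition _ (R : realType) :=
  Measure_isSigmaFinite.Build _ _ R (@lebesgue3 R)
    (sigma_finite_prod (@lebesgue2 R) (@lebesgue_measure R)).

(** * The Newton potential as an integral over time *)

Section newton_potential.
Context {R : realType}.
Implicit Types (x : 'rV[R]_3) (p : prodR3 R) (r : R) (M : nat).
Local Notation mu := (@lebesgue_measure R).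
Local Notation mu3 := (@lebesgue3 R).

Lemma eta3_rV3 M p : eta3 M (rV3 p) = Defs.eta M (p.1.1 : R) * Defs.eta M (p.1.2 : R) * Defs.eta M (p.2 : R).
Proof. by rewrite /eta3 prod3E !mxE. Qed.

(** The integrand in (p, r) on R^3 times the half-line whose two iterated integrals
    are the Newton potential and the time integral of heat_prod. *)
Definition heat_integrand M x p r : R :=
  (Defs.eta M p.1.1 * heat_kernel (x 0 0 - p.1.1) r) *
  (Defs.eta M p.1.2 * heat_kernel (x 0 1 - p.1.2) r) *
  (Defs.eta M p.2 * heat_kernel (x 0 ord_max - p.2) r).

Lemma heat_integrand_le0 M x p r : r <= 0 -> heat_integrand M x p r = 0.
Proof. by move=> r0; rewrite /heat_integrand heat_kernel_le0// !mulr0 !mul0r. Qed.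

Lemma measurable_heat_integrand M x : (1 <= M)%N ->
  measurable_fun setT (fun q : prodR3 R * measurableTypeR R => heat_integrand M x q.1 q.2).
Proof.
move=> M1.
have me : measurable_fun setT (@Defs.eta R M).
  by apply: continuous_measurable_fun; exact: continuous_eta.
have mterm (c : prodR3 R * measurableTypeR R -> R) (a : R) : measurable_fun setT c ->
    measurable_fun setT (fun q => Defs.eta M (c q) * heat_kernel (a - c q) q.2).
  move=> mc; apply: measurable_funM; first exact: (measurableT_comp me mc).
  by apply: measurable_heat_kernel; [exact: measurable_funB|exact: measurable_snd].
have m1 : measurable_fun setT (fun q : prodR3 R * measurableTypeR R => q.1.1.1 : R).
  by do 2 (apply: measurableT_comp; first exact: measurable_fst); exact: measurable_fst.
have m2 : measurable_fun setT (fun q : prodR3 R * measurableTypeR R => q.1.1.2 : R).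
  apply: measurableT_comp; first exact: measurable_snd.
  by apply: measurableT_comp; first exact: measurable_fst.
have m3 : measurable_fun setT (fun q : prodR3 R * measurableTypeR R => q.1.2 : R).
  by apply: measurableT_comp; [exact: measurable_snd|exact: measurable_fst].
by apply: measurable_funM; [apply: measurable_funM|]; exact: mterm.
Qed.

Lemma integral_mu3 (f g h : R -> R) :
  mu.-integrable setT (EFin \o f) -> mu.-integrable setT (EFin \o g) ->
  mu.-integrable setT (EFin \o h) ->
  mu3.-integrable setT (EFin \o (fun p : prodR3 R => f p.1.1 * g p.1.2 * h p.2)) /\
  \int[mu3]_p (f p.1.1 * g p.1.2 * h p.2) =
  (\int[mu]_y f y) * (\int[mu]_y g y) * (\int[mu]_y h y).
Proof.
move=> i_f i_g i_h.
have [i1 E1] := integrable_prodM i_f i_g.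
have [i2 E2] := @integrable_prodM R _ _ _ _ (@lebesgue2 R) (@lebesgue_measure R)
  (fun q => f q.1 * g q.2) h i1 i_h.
by split; [exact: i2|rewrite -E1; exact: E2].
Qed.

Lemma integral_heat_integrand M x r : (1 <= M)%N -> 0 < r ->
  mu3.-integrable setT (EFin \o (fun p => heat_integrand M x p r)) /\
  \int[mu3]_p heat_integrand M x p r = heat_prod M (fun=> 0%N) x r.
Proof.
move=> M1 r0.
have [i0 E0] := eta_conv (x 0 0) M1 r0.
have [i1 E1] := eta_conv (x 0 1) M1 r0.
have [i2 E2] := eta_conv (x 0 ord_max) M1 r0.
have [I E] := integral_mu3 i0 i1 i2.
by split; [exact: I|rewrite /heat_prod prod3E -E0 -E1 -E2; exact: E].
Qed.

(** The absolute value of eta is dominated by a Gaussian whose evolution under the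
    heat flow is of order (1 + r)^(-1/2) in each variable. *)
Lemma heat_integrand_bound M : (1 <= M)%N -> exists2 K : R, 0 <= K & forall x r, 0 < r ->
  \int[mu3]_p `|heat_integrand M x p r| <= K * heat_scale r ^+ 3.
Proof.
move=> M1; have [C C0 hC] := @eta_bound R M M1.
pose K := C * Num.sqrt (pi * 2).
have K0 : 0 <= K by rewrite mulr_ge0 ?sqrtr_ge0.
exists (K ^+ 3); first exact: exprn_ge0.
move=> x r r0.
have b (a : R) : mu.-integrable setT (EFin \o (fun y => `|Defs.eta M y * heat_kernel (a - y) r|)) /\
    \int[mu]_y `|Defs.eta M y * heat_kernel (a - y) r| <= K * heat_scale r.
  have [i_e _] := eta_conv a M1 r0; have i_n := integrable_norm i_e; split=> //.
  have iG := integrable_scale C measurableT (integrable_gauss_conv a 0 (ltr0n R 2) r0).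
  apply: (@le_trans _ _ (\int[mu]_y (C * (expR (- ((y - 0) ^+ 2 / 2)) * heat_kernel (a - y) r)))).
    apply: le_Rintegral => // y _.
    by rewrite normrM (ger0_norm (heat_kernel_ge0 _ _)) mulrA ler_wpM2r ?heat_kernel_ge0// subr0.
  rewrite RintegralZl//; last exact: (integrable_gauss_conv a 0 (ltr0n R 2) r0).
  rewrite integral_gauss_conv// /K -[leRHS]mulrA ler_wpM2l//.
  have r2 : 0 < 2 + r by lra.
  have r1 : 0 < 1 + r by lra.
  rewrite [in leLHS]sqrtrM ?mulr_ge0 ?pi_ge0// sqrtrV ?(ltW r2)// -[leLHS]mulrA ler_wpM2l ?sqrtr_ge0//.
  apply: (@le_trans _ _ (Num.sqrt (2 + r))^-1).
    rewrite ler_piMr ?invr_ge0 ?sqrtr_ge0// -[leRHS]expR0 ler_expR oppr_le0.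
    by rewrite divr_ge0 ?sqr_ge0 ?(ltW r2).
  by rewrite /heat_scale /inv_sqrt lef_pV2 ?posrE ?sqrtr_gt0// ler_wsqrtr//; lra.
have [i0 b0] := b (x 0 0); have [i1 b1] := b (x 0 1); have [i2 b2] := b (x 0 ord_max).
have [_ E] := integral_mu3 i0 i1 i2.
have -> : \int[mu3]_p `|heat_integrand M x p r| = \int[mu3]_p
   (`|Defs.eta M p.1.1 * heat_kernel (x 0 0 - p.1.1) r| *
    `|Defs.eta M p.1.2 * heat_kernel (x 0 1 - p.1.2) r| *
    `|Defs.eta M p.2 * heat_kernel (x 0 ord_max - p.2) r|).
  by apply: eq_Rintegral => p _; rewrite /heat_integrand !normrM.
rewrite E -exprMn exprSr expr2.
have pos a : 0 <= \int[mu]_y `|Defs.eta M y * heat_kernel (a - y) r| by apply: Rintegral_ge0.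
by apply: ler_pM; rewrite ?mulr_ge0 ?pos// ler_pM ?pos.
Qed.
End newton_potential.

Section newton_potential_formula.
Context {R : realType}.
Implicit Types (x : 'rV[R]_3) (p : prodR3 R) (r : R) (M : nat).
Local Notation mu := (@lebesgue_measure R).
Local Notation mu3 := (@lebesgue3 R).

Lemma integral_support_itv0y (G : R -> \bar R) : (forall r, r < 0 -> G r = 0%E) ->
  (\int[mu]_r G r = \int[mu]_(r in `[0%R, +oo[) G r)%E.
Proof.
move=> G0; rewrite [RHS]integral_mkcond; apply: eq_integral => r _.
rewrite patchE; case: ifPn => //; rewrite notin_setE/= in_itv/= andbT => /negP.
by rewrite -ltNge => /G0.
Qed.

Lemma integrable_heat_integrand_prod M x : (1 <= M)%N ->
  (mu3 \x mu)%E.-integrable setT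
    (EFin \o (fun q : prodR3 R * measurableTypeR R => heat_integrand M x q.1 q.2)).
Proof.
move=> M1; set f := EFin \o _.
have mf : measurable_fun setT f.
  by apply/measurable_EFinP; exact: measurable_heat_integrand.
have [K K0 hK] := @heat_integrand_bound R M M1.
apply/(integrable21ltyP _ _ mf).
pose G (r : R) := (\int[mu3]_p `|f (p, r)|)%E.
have mG : measurable_fun setT G.
  apply: (@measurable_fun_fubini_tonelli_G _ _ _ _ R mu3 (abse \o f)) => [|q]; last exact: abse_ge0.
  by apply: measurableT_comp; [exact: abse_measurable|exact: mf].
have GE r : 0 < r -> G r = (\int[mu3]_p `|heat_integrand M x p r|)%:E.
  move=> r0; have [i_f _] := integral_heat_integrand x M1 r0.
  by rewrite /Rintegral fineK//; apply: (integrable_fin_num _ (integrable_norm i_f)).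
have G0 r : r <= 0 -> G r = 0%E.
  move=> r0; rewrite /G; under eq_integral do rewrite /f /= heat_integrand_le0// normr0.
  exact: integral0.
rewrite -[X in (X < _)%E]/(\int[mu]_r G r)%E (integral_support_itv0y (fun r h => G0 r (ltW h))).
have iK := integrable_heat_scale3 K.
apply: (@le_lt_trans _ _ (\int[mu]_(r in `[0%R, +oo[) (K * heat_scale r ^+ 3)%:E)%E).
  apply: ge0_le_integral => //.
  - by move=> r _; exact: integral_ge0.
  - exact: measurable_funTS mG.
  - by have /integrableP[] := iK.
  - move=> r _; have [r0|r0] := ltP 0 r; first by rewrite GE// lee_fin hK.
    by rewrite G0// lee_fin mulr_ge0// exprn_ge0// heat_scale_ge0.
by rewrite ltey_eq (integrable_fin_num _ iK).
Qed.

(** The three Gaussians multiply to a function of the Euclidean norm. *)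
Lemma integral_heat_kernel3 (z : 'rV[R]_3) : 0 < enorm z ->
  (\int[mu]_r (heat_kernel (z 0 0) r * heat_kernel (z 0 1) r * heat_kernel (z 0 ord_max) r)%:E
   = (Num.sqrt pi / enorm z)%:E)%E.
Proof.
move=> z0; rewrite integral_support_itv0y; last first.
  by move=> r r0; rewrite heat_kernel_le0 ?mul0r// ltW.
rewrite -integral_inv_sqrt3_gauss//; apply: eq_integral => r _; congr EFin.
rewrite /heat_kernel /gauss_fun !exprMn enorm_sqr sum3E mulrDl mulrDl !opprD !expRD.
by rewrite !exprS expr0; ring.
Qed.

Lemma integral_time_heat_integrand M x p : 0 < enorm (x - rV3 p) ->
  (\int[mu]_r (heat_integrand M x p r)%:E =
   (Num.sqrt pi * newton_integrand (eta3 M) x p)%:E)%E.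
Proof.
move=> xp; pose z := x - rV3 p.
have -> : (fun r => (heat_integrand M x p r)%:E) = (fun r => (eta3 M (rV3 p))%:E *
   (heat_kernel (z 0 0) r * heat_kernel (z 0 1) r * heat_kernel (z 0 ord_max) r)%:E)%E.
  apply/funext => r; rewrite -EFinM eta3_rV3 /heat_integrand /z !mxE /=; congr EFin; ring.
have K := integral_heat_kernel3 xp.
have iK : mu.-integrable setT (fun r : R =>
  (heat_kernel (z 0 0) r * heat_kernel (z 0 1) r * heat_kernel (z 0 ord_max) r)%:E).
  apply/integrableP; split.
    have mk a : measurable_fun setT (heat_kernel a : R -> R).
      by apply: (@measurable_heat_kernel R _ (measurableTypeR R) (cst a) id).
    by apply/measurable_EFinP; apply: measurable_funM; [apply: measurable_funM|]; exact: mk.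
  under eq_integral => r _.
    rewrite gee0_abs; last by rewrite lee_fin; apply: mulr_ge0; [apply: mulr_ge0|]; exact: heat_kernel_ge0.
    over.
  by rewrite K ltry.
rewrite integralZl// K -EFinM /newton_integrand; congr EFin; ring.
Qed.

Lemma enorm_eq0 (z : 'rV[R]_3) : (enorm z == 0) = (z == 0).
Proof.
apply/idP/eqP => [/eqP z0|->].
  apply/rowP => j; apply/eqP; rewrite mxE -normr_eq0 eq_le normr_ge0 andbT.
  by rewrite -z0 coord_le_enorm.
rewrite /enorm sqrtr_eq0 le_eqVlt big1 ?eqxx// => j _.
by rewrite mxE expr0n.
Qed.

Definition point3 x : prodR3 R := ((x 0 0, x 0 1), x 0 ord_max).

Lemma enorm_sub_gt0 x p : p <> point3 x -> 0 < enorm (x - rV3 p).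
Proof.
move=> px; rewrite lt_neqAle enorm_ge0 andbT eq_sym enorm_eq0 subr_eq0.
apply/eqP => xp; apply: px; rewrite xp /point3 !mxE /=.
by case: p {xp} => [[a b] c].
Qed.

Lemma set1_prod3 p : [set p] = ([set p.1.1] `*` [set p.1.2]) `*` [set p.2].
Proof. by apply/seteqP; case: p => [[a b] c]; split=> [q ->//|[[a' b'] c'] /= [[-> ->] ->]]. Qed.

Lemma measurable_point3 p : measurable [set p].
Proof. by rewrite set1_prod3; do 2?apply: measurableX. Qed.

Lemma lebesgue3_point p : mu3 [set p] = 0%E.
Proof.
rewrite set1_prod3.
rewrite /lebesgue3 product_measure1E//=; last exact: measurableX.
by rewrite lebesgue_measure_set1 mule0.
Qed.

Lemma measurable_newton_integrand M x : (1 <= M)%N ->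
  measurable_fun setT (newton_integrand (eta3 M) x).
Proof.
move=> M1.
have me : measurable_fun setT (@Defs.eta R M).
  by apply: continuous_measurable_fun; exact: continuous_eta.
have m1 : measurable_fun setT (fun p : prodR3 R => p.1.1 : R).
  by apply: measurableT_comp; exact: measurable_fst.
have m2 : measurable_fun setT (fun p : prodR3 R => p.1.2 : R).
  by apply: measurableT_comp; [exact: measurable_snd|exact: measurable_fst].
have m3 : measurable_fun setT (fun p : prodR3 R => p.2 : R) by exact: measurable_snd.
have -> : newton_integrand (eta3 M) x = (fun p =>
  (Defs.eta M (p.1.1 : R) * Defs.eta M (p.1.2 : R) * Defs.eta M (p.2 : R)) *
  inv_sqrt ((x 0 0 - p.1.1) ^+ 2 + (x 0 1 - p.1.2) ^+ 2 + (x 0 ord_max - p.2) ^+ 2)).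
  by apply/funext => p; rewrite /newton_integrand eta3_rV3 /enorm sum3E !mxE.
apply: measurable_funM.
  by apply: measurable_funM; [apply: measurable_funM|]; exact: measurableT_comp.
apply: (measurableT_comp measurable_inv_sqrt).
by apply: measurable_funD; [apply: measurable_funD|];
  apply: measurable_funX; apply: measurable_funB.
Qed.

(** Fubini for heat_integrand.  Integration over r first gives sqrt pi times the Newton
    integrand, except at the point p = x; integration over p first gives heat_prod. *)
Lemma newton_potential_heat M x : (1 <= M)%N ->
  mu3.-integrable setT (EFin \o newton_integrand (eta3 M) x) /\
  harmonic_potential (eta3 M) x =
    (4 * Num.sqrt pi ^+ 3)^-1 * heat_integral M (fun=> 0%N) x.
Proof.
move=> M1; have I := integrable_heat_integrand_prod x M1.
set f := EFin \o _ in I.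
have IF := integrable_fubini_F I.
have FG := Fubini I.
(* at p = x the integral over r diverges, while the Newton integrand is 0 *)
pose N := [set point3 x].
have mN : measurable N by exact: measurable_point3.
have N0 : mu3 N = 0%E by exact: lebesgue3_point.
have s0 : Num.sqrt pi != 0 :> R by rewrite sqrtr_eq0 -ltNge pi_gt0.
have FE p : (setT `\` N) p -> fubini_F mu f p = (Num.sqrt pi * newton_integrand (eta3 M) x p)%:E.
  by move=> [_ Np]; apply: integral_time_heat_integrand; exact: enorm_sub_gt0.
have mn := measurable_newton_integrand x M1.
have In : mu3.-integrable setT (EFin \o (fun p => Num.sqrt pi * newton_integrand (eta3 M) x p)).
  apply/(negligible_integrable mN measurableT _ N0).
    by apply/measurable_EFinP; exact: measurable_funM.
  have mF : measurable_fun setT (fubini_F mu f) by case/integrableP: IF.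
  have /(negligible_integrable mN measurableT mF N0) := IF.
  by apply: eq_integrable => [|p]; [exact: measurableD|rewrite inE => /FE].
have Inewton : mu3.-integrable setT (EFin \o newton_integrand (eta3 M) x).
  have := integrable_scale (Num.sqrt pi)^-1 measurableT In.
  by apply: eq_integrable => // p _ /=; rewrite mulKf.
split=> //.
have EF : (\int[mu3]_p fubini_F mu f p = (Num.sqrt pi * \int[mu3]_p newton_integrand (eta3 M) x p)%:E)%E.
  rewrite (negligible_integral mN measurableT IF N0).
  rewrite (eq_integral (EFin \o (fun p => Num.sqrt pi * newton_integrand (eta3 M) x p))); last first.
    by move=> p; rewrite inE => /FE.
  rewrite -(negligible_integral mN measurableT In N0).
  rewrite -RintegralZl// /Rintegral fineK//.
  exact: integrable_fin_num In.
have EG : (\int[mu]_r fubini_G mu3 f r = (heat_integral M (fun=> 0%N) x)%:E)%E.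
  have GE r : 0 < r -> fubini_G mu3 f r = (heat_prod M (fun=> 0%N) x r)%:E.
    move=> r0; have [i_f <-] := integral_heat_integrand x M1 r0.
    by rewrite /Rintegral fineK//; exact: integrable_fin_num i_f.
  rewrite integral_support_itv0y; last first.
    move=> r r0; rewrite /fubini_G; under eq_integral do rewrite /f /= heat_integrand_le0 ?(ltW r0)//.
    exact: integral0.
  have mG : measurable_fun setT (fubini_G mu3 f) by exact: (measurable_fubini_G I).
  rewrite -integral_itv_obnd_cbnd; last exact: measurable_funTS mG.
  have iH := @integrable_heat_prod R M (fun=> 0%N) x.
  rewrite /heat_integral /Rintegral fineK; last exact: integrable_fin_num iH.
  rewrite -[RHS]integral_itv_obnd_cbnd; last first.
    apply: measurable_funS (measurable_int _ iH) => // r.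
    by rewrite /= !in_itv/= !andbT; exact: ltW.
  by apply: eq_integral => r; rewrite inE/= in_itv/= andbT => /GE.
have : (Num.sqrt pi * \int[mu3]_p newton_integrand (eta3 M) x p) = heat_integral M (fun=> 0%N) x.
  by apply: EFin_inj; rewrite -EF -EG; exact: FG.
move=> <-; rewrite /harmonic_potential; set I3 := \int[_]_p _.
have -> : pi = Num.sqrt pi ^+ 2 :> R by rewrite sqr_sqrtr ?pi_ge0.
rewrite sqrtr_sqr ger0_norm ?sqrtr_ge0//.
by field.
Qed.
End newton_potential_formula.

(** * The explicit integrands and the theorem *)

Section explicit_integrands.
Context {R : realType}.
Implicit Types (x : 'rV[R]_3) (r : R) (M : nat) (i : 'I_3).
Local Notation mu := (@lebesgue_measure R).
Local Notation n0 := (fun=> 0%N).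

Lemma heat_prod0E M x r : -1 < r ->
  heat_prod M n0 x r =
  expR (- (enorm x ^+ 2 / (1 + r))) * \prod_(j < 3) calQ M (x 0 j) r.
Proof.
move=> r1; rewrite enorm_sqr mulr_suml -sumrN expR_sum -big_split /=.
by apply: eq_bigr => j _; rewrite heat_eta0E.
Qed.

(** The j = i factor is differentiated: its derivative is a multiple of R_M minus
    2 x_i / (1 + r) times the original factor. *)
Lemma heat_prod1E M x r i : (1 <= M)%N -> -1 < r ->
  expR (- (enorm x ^+ 2 / (1 + r))) * calR M (x 0 i) r
    * \prod_(j < 3 | j != i) calQ M (x 0 j) r =
  heat_prod M (incr n0 i) x r + 2 * x 0 i / (1 + r) * heat_prod M n0 x r.
Proof.
move=> M1 r1; rewrite enorm_sqr mulr_suml -sumrN expR_sum (bigD1 i)//=.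
have D n : heat_prod M n x r = heat_eta M (n i) (x 0 i) r *
    \prod_(j < 3 | j != i) heat_eta M (n j) (x 0 j) r.
  by rewrite /heat_prod (bigD1 i).
rewrite !D /incr eqxx /=.
have -> : \prod_(j < 3 | j != i) heat_eta M (0 + (j == i)) (x 0 j) r =
    \prod_(j < 3 | j != i) heat_eta M 0 (x 0 j) r.
  by apply: eq_bigr => j /negPf ->.
have <- : \prod_(j < 3 | j != i) expR (- (x 0 j ^+ 2 / (1 + r))) *
    \prod_(j < 3 | j != i) calQ M (x 0 j) r =
    \prod_(j < 3 | j != i) heat_eta M 0 (x 0 j) r.
  by rewrite -big_split; apply: eq_bigr => j _; rewrite heat_eta0E.
have := calR_heat (x 0 i) M1 r1.
set ei := expR _; set E := \prod_(_ < _ | _) expR _; set Q := \prod_(_ < _ | _) _.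
move=> h; transitivity ((ei * calR M (x 0 i) r) * (E * Q)); first ring.
by rewrite h; ring.
Qed.

Lemma integrable_heat_prod_weight M x : mu.-integrable `[0, +oo[
  (EFin \o (fun r : R => (1 + r)^-1 * heat_prod M n0 x r)).
Proof.
have [C C0 hC] := @heat_prod_bound R M n0.
have [||I _] := @heat_dominated R (fun r => heat_scale r ^+ 2 * heat_prod M n0 x r) C.
- move=> r r0; apply: cvgM; last exact: continuous_heat_prod.
  apply: (cvg_comp heat_scale (fun y => y ^+ 2)); last exact: exprn_continuous.
  by apply: is_derive_continuous; apply: is_derive_heat_scale; lra.
- move=> r r0; rewrite normrM ger0_norm ?exprn_ge0 ?heat_scale_ge0//.
  apply: le_trans (hC x r r0); rewrite ler_piMl// exprn_ile1 ?heat_scale_ge0//.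
  exact: heat_scale_le1.
apply: eq_integrable I => // r; rewrite inE/= in_itv/= andbT => r0.
by rewrite heat_scaleX2//; lra.
Qed.

Lemma powR_pi32 : pi `^ (3 / 2) = Num.sqrt pi ^+ 3 :> R.
Proof.
by rewrite powRrM powRAC powR12_sqrt ?pi_ge0// powR_mulrn ?sqrtr_ge0.
Qed.

Lemma eta3_heat_prod M : (1 <= M)%N ->
  eta3 M = (fun x => (Num.sqrt pi ^+ 3)^-1 * heat_prod M n0 x 0).
Proof.
move=> M1; apply/funext => x; rewrite /eta3 /heat_prod.
under eq_bigr do rewrite eta_heat_eta//.
by rewrite big_split /= prodr_const card_ord exprVn.
Qed.

Lemma is_derive_eta3 M i x : (1 <= M)%N ->
  is_derive x (delta_mx 0 i) (eta3 M)
    ((Num.sqrt pi ^+ 3)^-1 * heat_prod M (incr n0 i) x 0).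
Proof.
move=> M1; rewrite eta3_heat_prod//.
have h := is_derive_heat_prod_line M n0 x i 0 0; rewrite scale0r add0r in h.
exact: (is_deriveZ (Num.sqrt pi ^+ 3)^-1 (is_derive_line h)).
Qed.
End explicit_integrands.

Theorem theorem3p2 (R : realType) (M : nat) (i : 'I_3) (hM : (1 <= M)%N) :
  let F : 'rV[R]_3 -> R := eta3 M in
  let v : 'rV[R]_3 -> R := partial i (harmonic_potential F) in
  let I1 (x : 'rV[R]_3) (r : R) : R :=
    expR (- (enorm x ^+ 2 / (1 + r))) / (1 + r)
    * \prod_(j < 3) calQ M (x 0 j) r in
  let I2 (x : 'rV[R]_3) (r : R) : R :=
    expR (- (enorm x ^+ 2 / (1 + r))) * calR M (x 0 i) r
    * \prod_(j < 3 | j != i) calQ M (x 0 j) r in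
  (* the objects in the statement are well defined *)
  [/\ forall x, derivable F x (delta_mx 0 i),
      forall x, lebesgue3.-integrable setT (EFin \o newton_integrand F x),
      forall x, derivable (harmonic_potential F) x (delta_mx 0 i) &
      forall x,
        lebesgue_measure.-integrable `[0, +oo[ (EFin \o I1 x) /\
        lebesgue_measure.-integrable `[0, +oo[ (EFin \o I2 x)] /\
  (* v is the solution of the boundary value problem *)
  (poisson_solution (partial i F) v /\
   forall w, poisson_solution (partial i F) w -> w = v) /\
  (* one-dimensional integral representation *)
  (forall x : 'rV[R]_3,
     v x = - (x 0 i / (2 * pi `^ (3 / 2)))
             * (\int[lebesgue_measure]_(r in `[0, +oo[) I1 x r)
           + (4 * pi `^ (3 / 2))^-1
             * (\int[lebesgue_measure]_(r in `[0, +oo[) I2 x r)) /\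
  (* R_M = d/dx Q_M in closed form *)
  ((1 < M)%N -> forall x r : R, 0 <= r ->
     derivable (fun y : R => calQ M y r) x 1 /\
     calR M x r =
       \sum_(1 <= k < M)
         ((1 + r) ^+ k.+1)^-1 * ((-1) ^+ k / (4 ^+ k.-1 * k.-1`!%:R))
         * hermite (2 * k).-1 (x / Num.sqrt (1 + r))).
Proof.
move=> F v I1 I2.
pose n0 : 'I_3 -> nat := fun=> 0%N.
pose c : R := (4 * Num.sqrt pi ^+ 3)^-1.
have s0 : Num.sqrt pi != 0 :> R by rewrite sqrtr_eq0 -ltNge pi_gt0.
have uE : harmonic_potential F = (fun x => c * heat_integral M n0 x).
  by apply/funext => x; have [] := newton_potential_heat x hM.
have vE : v = (fun x => c * heat_integral M (incr n0 i) x).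
  by rewrite /v uE partial_heat_integral.
have dF : partial i F = (fun x => (Num.sqrt pi ^+ 3)^-1 * heat_prod M (incr n0 i) x 0).
  by apply/funext => x; apply: derive_val; exact: is_derive_eta3.
have I1E x r : 0 <= r -> I1 x r = (1 + r)^-1 * heat_prod M n0 x r.
  by move=> r0; rewrite heat_prod0E /I1; [ring|lra].
have I2E x r : 0 <= r -> I2 x r = heat_prod M (incr n0 i) x r +
    2 * x 0 i * ((1 + r)^-1 * heat_prod M n0 x r).
  by move=> r0; rewrite /I2 heat_prod1E//; [ring|lra].
have i1 x := @integrable_heat_prod_weight R M x.
have i2 x := @integrable_heat_prod R M (incr n0 i) x.
have i12 (x : 'rV[R]_3) : lebesgue_measure.-integrable `[0, +oo[
    (EFin \o (fun r : R => 2 * x 0 i * ((1 + r)^-1 * heat_prod M n0 x r))).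
  exact: integrable_scale.
have sol : poisson_solution (partial i F) v.
  split.
  - by rewrite vE; exact: classC2_heat_integral.
  - move=> x; rewrite dF vE /laplacian.
    have -> : \sum_(j < 3) partial j (partial j (fun x => c * heat_integral M (incr n0 i) x)) x =
        c * \sum_(j < 3) heat_integral M (incr (incr (incr n0 i) j) j) x.
      by rewrite mulr_sumr; apply: eq_bigr => j _; rewrite !partial_heat_integral.
    by rewrite laplacian_heat_integral /c; field.
  - by rewrite vE; exact: heat_integral_vanishes.
split; [split|split; [|split]].
- by move=> x; have [] := is_derive_eta3 i x hM.
- by move=> x; have [] := newton_potential_heat x hM.
- by move=> x; rewrite uE; exact: derivable_heat_integral.
- move=> x; split.
    apply: eq_integrable (i1 x) => // r; rewrite inE/= in_itv/= andbT => r0.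
    by rewrite I1E.
  have i3 : lebesgue_measure.-integrable `[0, +oo[ (EFin \o (fun r : R =>
      heat_prod M (incr n0 i) x r + 2 * x 0 i * ((1 + r)^-1 * heat_prod M n0 x r))).
    exact: integrable_add.
  apply: eq_integrable i3 => // r; rewrite inE/= in_itv/= andbT => r0.
  by rewrite I2E.
- by split=> // w hw; exact: poisson_unique hw sol.
- move=> x; rewrite vE powR_pi32.
  have E1 : \int[lebesgue_measure]_(r in `[0, +oo[) I1 x r =
      \int[lebesgue_measure]_(r in `[0, +oo[) ((1 + r)^-1 * heat_prod M n0 x r).
    by apply: eq_Rintegral => r; rewrite inE/= in_itv/= andbT => /I1E ->.
  have E2 : \int[lebesgue_measure]_(r in `[0, +oo[) I2 x r = heat_integral M (incr n0 i) x +
      2 * x 0 i * \int[lebesgue_measure]_(r in `[0, +oo[) ((1 + r)^-1 * heat_prod M n0 x r).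
    rewrite -RintegralZl// -RintegralD//.
    by apply: eq_Rintegral => r; rewrite inE/= in_itv/= andbT => /I2E ->.
  rewrite E1 E2 /c; set J := \int[_]_(_ in _) _.
  by field.
- move=> M1 x r r0; have r1 : -1 < r by lra.
  have dQ := is_derive_calQ M x r1; split; first by case: dQ.
  rewrite /calR; case: eqP => [M0|_]; first by rewrite M0 in M1.
  by rewrite derive1E; exact: (@derive_val _ _ _ _ _ _ _ dQ).
Qed.
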